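(* Let $p\ge 1$ be real, let $d\ge 1$ be an integer, and let $K,L\subset\mathbb{R}^d$ be convex bodies with $K\ne L$. Then $$\delta_p^*(K,L)\ \ge\ \frac14\,\delta(K,L)\,\exp\left(-\frac{1}{2\pi}\left(\frac{V_1\left(\overline{\mathrm{conv}}(K\cup L)\right)}{\delta(K,L)}\right)^2\right).$$
   Context: A convex body in $\mathbb{R}^d$ is a nonempty compact convex subset of $\mathbb{R}^d$ (it need not have interior points). Its support function is $h_K(x)=\max_{y\in K}\langle x,y\rangle$ for $x\in\mathbb{R}^d$. Let $Z^{(d)}=(Z_1,\ldots,Z_d)$ be a vector of independent standard Gaussian random variables. For $1\le p<\infty$ and convex bodies $K,L\subset\mathbb{R}^d$, the intrinsic $L_p$ metric is $$\delta_p^*(K,L)=\left[c_p\,E\left|h_K(Z^{(d)})-h_L(Z^{(d)})\right|^p\right]^{1/p},\qquad c_p=\frac{1}{E|Z_1|^p}=\frac{\pi^{1/2}}{2^{p/2}\,\Gamma\left((p+1)/2\right)}.$$ $\delta(K,L)$ denotes the Hausdorff distance between $K$ and $L$ with respect to the Euclidean norm, equivalently $\delta(K,L)=\sup_{\|u\|=1}|h_K(u)-h_L(u)|$. $\overline{\mathrm{conv}}$ denotes closed convex hull. $V_1$ denotes the first intrinsic volume, normalized so that a segment has $V_1$ equal to its length; equivalently $V_1(K)=\sqrt{2\pi}\,E\,h_K(Z^{(d)})$. *)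

(* Defs.v *)
From mathcomp Require Export all_boot all_order all_algebra.
From mathcomp Require Export all_classical all_reals all_analysis.
Export Order.TTheory GRing.Theory Num.Theory.
Export numFieldNormedType.Exports.

Set Implicit Arguments.
Unset Strict Implicit.
Unset Printing Implicit Defensive.

Local Open Scope classical_set_scope.
Local Open Scope ring_scope.

Section Euclidean.
Context {R : realType} {d : nat}.
Implicit Types (x y : 'rV[R]_d) (A B K L : set 'rV[R]_d).

Definition dotp x y : R := \sum_(i < d) x 0 i * y 0 i.

(* The library norm of 'rV[R]_d is the max norm: it gives the right topology
   on R^d, but the Euclidean norm has to be introduced separately. *)
Definition enorm x : R := Num.sqrt (dotp x x).

Definition convex_body K : Prop :=
  [/\ K !=set0, compact K & convex_set (K : set (convex_lmodType 'rV[R]_d))].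

(* For a convex body the supremum is attained. *)
Definition support_fun K x : R := sup [set dotp x y | y in K].

Definition dist_to x A : R := inf [set enorm (x - y) | y in A].

Definition hausdorff_dist A B : R :=
  Num.max (sup [set dist_to x B | x in A]) (sup [set dist_to y A | y in B]).

Definition closed_convex_hull A : set 'rV[R]_d :=
  smallest
    [set C | closed C /\ convex_set (C : set (convex_lmodType 'rV[R]_d))] A.

End Euclidean.

Section Probability.
Context {R : realType} {disp : measure_display} {Omega : measurableType disp}.
Variable P : probability Omega R.

Definition mutually_independent (I : finType) (X : I -> {RV P >-> R}) : Prop :=
  forall (J : {set I}) (B : I -> set R), (forall i, measurable (B i)) ->
    P (\bigcap_(i in [set` J]) X i @^-1` B i) =
      (\prod_(i in J) P (X i @^-1` B i))%E.

(* normal_prob takes the mean and the standard deviation as parameters. *)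
Definition standard_normal (X : {RV P >-> R}) : Prop :=
  forall B : set R, measurable B ->
    distribution P X B = normal_prob (0 : R) (1 : R) B.

Definition standard_gaussian_vector (d : nat) (Z : 'I_d -> {RV P >-> R}) :
    Prop :=
  (forall i, standard_normal (Z i)) /\ mutually_independent Z.

End Probability.

(* c_p = 1 / E|N|^p with N standard normal, the expectation being computed
   under the law of N. *)
Definition cst_p {R : realType} (p : R) : R :=
  (fine 'E_(normal_prob (0 : R) (1 : R))[fun x : R => `|x| `^ p])^-1.

(* The expectations below are finite for convex bodies and a standard Gaussian
   vector Z, so that `fine` only converts from \bar R to R; the values depend
   on Z only through its law. *)
Section Gaussian.
Context {R : realType} {disp : measure_display} {Omega : measurableType disp}.
Context {P : probability Omega R} {d : nat}.
Variable Z : 'I_d -> {RV P >-> R}.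
Implicit Types K L : set 'rV[R]_d.

Definition rvec (w : Omega) : 'rV[R]_d := \row_i Z i w.

Definition intrinsic_Lp_dist (p : R) K L : R :=
  (cst_p p * fine 'E_P[fun w =>
      `|support_fun K (rvec w) - support_fun L (rvec w)| `^ p]) `^ p^-1.

(* Gaussian representation of the first intrinsic volume, in the normalization
   for which a segment has V_1 equal to its length. *)
Definition intrinsic_volume1 K : R :=
  Num.sqrt (2 * pi) * fine 'E_P[fun w => support_fun K (rvec w)].

End Gaussian.

(* Main.v *)
(** Let [delta] be the Hausdorff distance, [M] the closed convex hull of the
    union of [K] and [L], and [Z] the Gaussian vector.  Separating a farthest
    point [x] of (say) [K] from [L] gives a unit vector [u] with
    [<u, x> >= h_L(u) + delta].  Split [Z = t u + W] into its component along
    [u] and an independent remainder.  Subadditivity of the support functions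
    gives [h_K(Z) - h_L(Z) >= delta t - (h_M(W) - <x, W>)] for [t >= 0], where
    the subtracted term is nonnegative and, by Jensen's inequality, has
    expectation at most [v = E h_M(Z) = V_1(M) / sqrt (2 pi)].  Jensen's
    inequality in [W] for the convex function [y |-> max(y, 0)^p] then yields
    [E |h_K(Z) - h_L(Z)|^p >= delta^p E max(t - a, 0)^p] with
    [a = v / delta], and the last moment is bounded below through
    [(s + a)^2 <= 2 s^2 + 2 a^2].

    The independence of [t] and [W] is obtained by turning [u] into a
    coordinate vector with plane rotations; each of them preserves standard
    Gaussian vectors by two affine changes of variables on the line. *)

From HB Require Import structures.
Require Import Defs.
From mathcomp Require Import measurable_realfun ring lra.

Set Implicit Arguments.
Unset Strict Implicit.
Unset Printing Implicit Defensive.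

Local Open Scope classical_set_scope.
Local Open Scope ring_scope.

(** * Measurability, densities and affine substitution *)

(** Storing the measurability proof makes the image a bundled measure, to which rescaling and the
    uniqueness theorems for measures apply. *)
Definition pushforward_along d1 d2 (T1 : measurableType d1)
    (T2 : measurableType d2) (R : realType) (f : T1 -> T2)
    (mf : measurable_fun setT f) (m : {measure set T1 -> \bar R}) :
  {measure set T2 -> \bar R}.
Proof. by refine (pushforward m f); exact: mf. Defined.

Section density.
Local Open Scope ereal_scope.
Context d (T : measurableType d) (R : realType).
Variables (mu nu : {measure set T -> \bar R}) (g : T -> R).
Hypotheses (mg : measurable_fun setT g) (g0 : forall x, (0 <= g x)%R).
Hypothesis nuE : forall A, measurable A -> nu A = \int[mu]_(x in A) (g x)%:E.

Import HBNNSimple.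

(** By monotone convergence both sides are limits along the same simple functions increasing to [f];
    linearity then reduces the claim to indicators, where it is [nuE]. *)
Lemma ge0_integral_density (f : T -> \bar R) :
  measurable_fun setT f -> (forall x, 0 <= f x) ->
  \int[nu]_x f x = \int[mu]_x (f x * (g x)%:E).
Proof.
move=> mf f0; pose h := nnsfun_approx measurableT mf.
have mgE : measurable_fun setT (EFin \o g) by exact/measurable_EFinP.
have -> : \int[nu]_x f x = lim (\int[nu]_x (EFin \o h n) x @[n --> \oo]).
  have fE x : f x = lim ((EFin \o h n) x @[n --> \oo]).
    by apply/esym/cvg_lim => //; exact: cvg_nnsfun_approx.
  under eq_integral => x _ do rewrite fE.
  apply: monotone_convergence => //.
  - by move=> n; exact/measurable_EFinP.
  - by move=> n x _; rewrite lee_fin.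
  - by move=> x _ a b ab; rewrite lee_fin; exact/lefP/nd_nnsfun_approx.
have -> : \int[mu]_x (f x * (g x)%:E) =
    lim (\int[mu]_x ((EFin \o h n) x * (g x)%:E) @[n --> \oo]).
  have fg x : f x * (g x)%:E = lim (((EFin \o h n) x * (g x)%:E) @[n --> \oo]).
    by apply/esym/cvg_lim => //; apply: cvgeZr => //; exact: cvg_nnsfun_approx.
  under eq_integral => x _ do rewrite fg.
  apply: monotone_convergence => //.
  - by move=> n; apply/emeasurable_funM => //; exact/measurable_EFinP.
  - by move=> n x _; rewrite mule_ge0 ?lee_fin.
  - move=> x _ a b ab; rewrite lee_wpmul2r ?lee_fin//.
    exact/lefP/nd_nnsfun_approx.
congr (lim (_ @ \oo)); apply/funext => n.
transitivity (\int[nu]_x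
   (\sum_(y \in range (h n)) (y * \1_(h n @^-1` [set y]) x)%:E)).
  by apply: eq_integral => t _; rewrite /= fimfunE -fsumEFin.
rewrite ge0_integral_fsum//; last 2 first.
  - by move=> y; exact/measurable_EFinP/measurable_funM.
  - by move=> m y _; exact: nnfun_muleindic_ge0.
transitivity (\int[mu]_x (\sum_(y \in range (h n))
    (y * \1_(h n @^-1` [set y]) x)%:E * (g x)%:E)); last first.
  apply: eq_integral => x _; rewrite -ge0_mule_fsuml => [|y];
    last exact: nnfun_muleindic_ge0.
  by rewrite fsumEFin // -(fimfunE _ x).
rewrite ge0_integral_fsum//; last 2 first.
  - by move=> y; apply: emeasurable_funM => //;
    exact/measurable_EFinP/measurable_funM.
  - by move=> m y _; rewrite mule_ge0 ?lee_fin//; exact: nnfun_muleindic_ge0.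
apply: eq_fsbigr => r rhn.
under [LHS]eq_integral do rewrite EFinM.
rewrite integralZl_indic_nnsfun //.
under [RHS]eq_integral do rewrite EFinM -muleA.
rewrite ge0_integralZl//.
- congr (_ * _).
  under [RHS]eq_integral do rewrite muleC.
  rewrite [RHS](eq_integral ((EFin \o g) \_ (h n @^-1` [set r]))); last first.
    by move=> x xE; rewrite epatch_indic.
  by rewrite -integral_mkcondr setTI -nuE// integral_indic// setIT.
- by apply: emeasurable_funM => //; exact/measurable_EFinP.
- by move=> t _; rewrite mule_ge0 ?lee_fin.
- by move: rhn; rewrite inE => -[t _ <-]; rewrite lee_fin.
Qed.

End density.

Section affine.
Context {R : realType}.
Local Notation mu := (@lebesgue_measure R).
Variables (a b : R).
Hypothesis a0 : a != 0.

Let phi : R -> measurableTypeR R := fun x => a * x + b.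

Let mphi : measurable_fun [set: measurableTypeR R] phi.
Proof. by apply: measurable_funD => //; exact: measurable_funM. Qed.

Let aP : 0 < `|a|. Proof. by rewrite normr_gt0. Qed.

Let nu := mscale (NngNum (ltW aP)) (pushforward_along mphi mu).

(** Lebesgue measure is determined by its values on intervals []c, d]]. Such an interval pulls back
    to one of length (d - c) / |a|, which the factor |a| in [nu] corrects; for a < 0 the open end
    changes side, without effect on the length. *)
Lemma lebesgue_measure_affine (A : set R) : measurable A ->
  nu A = mu A.
Proof.
move=> mA; apply/esym/lebesgue_measure_unique => //= _ [[c d]] _ <-.
rewrite /nu /mscale /= /pushforward.
have [agt0|alt0|] := ltrgt0P a; last by move/eqP; rewrite (negbTE a0).
- have -> : phi @^-1` `]c, d] = `](c - b) / a, (d - b) / a]%classic.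
    apply/seteqP; split => x /=;
      rewrite !in_itv/= /phi ltr_pdivrMr// ler_pdivlMr//;
      by rewrite ltrBlDr lerBrDr (mulrC x).
  rewrite !lebesgue_measure_itv/= !lte_fin ltr_pM2r ?invr_gt0// ltrD2r.
  case: ifPn => _; last by rewrite mule0.
  by rewrite -!EFinB -EFinM; congr EFin; field; rewrite gt_eqF.
- have -> : phi @^-1` `]c, d] = `[(d - b) / a, (c - b) / a[%classic.
    apply/seteqP; split => x /=;
      rewrite !in_itv/= /phi ltr_ndivlMr// ler_ndivrMr//;
      by rewrite ltrBlDr lerBrDr (mulrC x) andbC.
  rewrite !lebesgue_measure_itv/= !lte_fin ltr_nM2r ?invr_lt0// ltrD2r.
  case: ifPn => _; last by rewrite mule0.
  by rewrite -!EFinB -EFinM; congr EFin; field; rewrite lt_eqF.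
Qed.

Lemma ge0_integral_affine (f : R -> \bar R) :
  measurable_fun setT f -> (forall x, 0 <= f x)%E ->
  (\int[mu]_x f x = `|a|%:E * \int[mu]_x f (a * x + b)%R)%E.
Proof.
move=> mf f0.
rewrite (@eq_measure_integral _ _ _ _ nu mu); last first.
  by move=> A mA _; apply/esym/lebesgue_measure_affine.
rewrite ge0_integral_mscale//=; congr (_ * _)%E.
by rewrite ge0_integral_pushforward//; exact: mphi.
Qed.

End affine.

(** An open set is the countable union of the open boxes with rational corners inside it, and the
    preimage of a box is a finite intersection of coordinate conditions. Balls are cubes here, so
    around each point a small enough box fits. *)
Lemma measurable_open_row (R : realType) (n : nat) disp (T : measurableType
  disp)
    (X : T -> 'rV[R]_n) (O : set 'rV[R]_n) :
  (forall i, measurable_fun setT (fun x => X x 0 i)) -> open O ->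
  measurable (X @^-1` O).
Proof.
move=> mX oO.
pose box (ab : 'rV[rat]_n * 'rV[rat]_n) : set 'rV[R]_n :=
  [set y | forall i, ratr (ab.1 0 i) < y 0 i < ratr (ab.2 0 i)].
pose F ab := if `[< box ab `<=` O >] then X @^-1` box ab else set0.
have -> : X @^-1` O = \bigcup_ab F ab.
  apply/seteqP; split => [x /= Ox|x [ab _]]; last first.
    by rewrite /F; case: asboolP => // sub; exact: sub.
  have /nbhs_ballP[e /= e0 xeO] := open_nbhs_nbhs (conj oO Ox).
  have /choice[a aP] (i : 'I_n) : exists q : rat, X x 0 i - e < ratr q < X x 0
    i.
    have [|q] := @rat_in_itvoo R (X x 0 i - e) (X x 0 i).
      by rewrite ltrBlDr ltrDl.
    by rewrite in_itv/=; exists q.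
  have /choice[b bP] (i : 'I_n) : exists q : rat, X x 0 i < ratr q < X x 0 i +
    e.
    have [|q] := @rat_in_itvoo R (X x 0 i) (X x 0 i + e).
      by rewrite ltrDl.
    by rewrite in_itv/=; exists q.
  exists (\row_i a i, \row_i b i) => //; rewrite /F; case: asboolP; last first.
    case=> y yP; apply: xeO; split=> // j i; rewrite ord1 /ball/= ltr_distl.
    have := yP i; rewrite !mxE /=.
    have := aP i; have := bP i; lra.
  move=> _ i; rewrite !mxE.
  by have /andP[_ ->] := aP i; have /andP[-> _] := bP i.
apply: countable_bigcupT_measurable => // ab; rewrite /F.
case: asboolP => // _.
rewrite (_ : X @^-1` _ = \bigcap_(i in [set: 'I_n])
  (fun x => X x 0 i) @^-1` `](ratr (ab.1 0 i)), (ratr (ab.2 0 i))[); last first.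
  apply/seteqP; split => x /= xP i; have := xP i; rewrite /= in_itv/=; exact.
apply: fin_bigcap_measurable => // i _.
by rewrite -[X in measurable X]setTI; exact: mX.
Qed.

Lemma measurable_continuous_row (R : realType) (n : nat) disp
    (T : measurableType disp) (X : T -> 'rV[R]_n) (G : 'rV[R]_n -> R) :
  (forall i, measurable_fun setT (fun x => X x 0 i)) -> continuous G ->
  measurable_fun setT (G \o X).
Proof.
move=> mX cG; apply: (measurability (@RGenOInfty.G R)).
  exact: RGenOInfty.measurableE.
move=> _ [_ [r ->] <-]; rewrite setTI comp_preimage.
apply: measurable_open_row => //.
by move/continuousP : cG; apply; exact: interval_open.
Qed.

(** * The standard normal law *)

Lemma measurable_idR (R : realType) :
  measurable_fun [set: measurableTypeR R] (id : measurableTypeR R -> R).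
Proof. exact: measurable_id. Qed.

(* [normal_prob] is a measure on [measurableTypeR R], whose sigma-algebra
   instance differs from the canonical one on [R] carried by random variables
   and products; [std_normal] takes the same values on the latter. *)
Definition std_normal {R : realType} : set R -> \bar R :=
  pushforward_along (@measurable_idR R) (normal_prob (0 : R) (1 : R)).

HB.instance Definition _ (R : realType) := Measure.on (@std_normal R).

Lemma std_normal_setT (R : realType) : @std_normal R setT = 1%E.
Proof. exact: (@probability_setT _ _ _ (normal_prob (0 : R) (1 : R))). Qed.

HB.instance Definition _ (R : realType) :=
  @Measure_isProbability.Build _ _ R (@std_normal R) (@std_normal_setT R).

Section standard_normal.
Context {R : realType}.
Local Notation mu := (@lebesgue_measure R).
Local Notation gamma := (@std_normal R).
Local Notation phi := (normal_pdf (0 : R) (1 : R)).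

Lemma std_normal_pdfE (x : R) :
  phi x = (Num.sqrt (2 * pi))^-1 * expR (- (x ^+ 2 / 2)).
Proof.
rewrite normal_pdfE// /normal_peak /normal_fun expr1n mul1r subr0 mulNr.
by rewrite -(mulr_natl pi).
Qed.

Lemma integral_std_normalE (f : R -> \bar R) :
  measurable_fun setT f -> (forall x, 0 <= f x)%E ->
  (\int[gamma]_x f x = \int[normal_prob (0 : R) (1 : R)]_x f x)%E.
Proof.
by move=> mf f0; rewrite ge0_integral_pushforward//; exact: measurable_idR.
Qed.

Lemma integral_std_normal (f : R -> \bar R) :
  measurable_fun setT f -> (forall x, 0 <= f x)%E ->
  (\int[gamma]_x f x = \int[mu]_x (f x * (phi x)%:E))%E.
Proof.
move=> mf f0; rewrite integral_std_normalE//.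
apply: ge0_integral_density => //.
- exact: measurable_normal_pdf.
- exact: normal_pdf_ge0.
Qed.

(** The rotation is factored into two one-variable affine substitutions with a Tonelli exchange
    between them; the first divides by [c]. The product density depends only on x^2 + y^2, hence is
    unchanged. *)
Lemma std_normal_rot (c s : R) (F : R * R -> \bar R) :
  c != 0 -> c ^+ 2 + s ^+ 2 = 1 ->
  measurable_fun setT F -> (forall z, 0 <= F z)%E ->
  (\int[gamma]_x \int[gamma]_y F (c * x + s * y, c * y - s * x)%R =
   \int[gamma]_x \int[gamma]_y F (x, y))%E.
Proof.
move=> c0 cs1 mF F0.
have mphi : measurable_fun setT (EFin \o phi).
  by apply/measurable_EFinP; exact: measurable_normal_pdf.
have phi0 x : (0 <= (phi x)%:E)%E by rewrite lee_fin normal_pdf_ge0.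
have dbl (G : R * R -> \bar R) : measurable_fun setT G ->
  (forall z, 0 <= G z)%E ->
    (\int[gamma]_x \int[gamma]_y G (x, y) =
     \int[mu]_x \int[mu]_y (G (x, y) * (phi y)%:E * (phi x)%:E))%E.
  move=> mG G0.
  have mGx x : measurable_fun setT (fun y => G (x, y)).
    by apply: measurableT_comp => //; exact: measurable_pair1.
  rewrite integral_std_normal//; last 2 first.
  - exact: (measurable_fun_fubini_tonelli_F (m2 := gamma)).
  - by move=> x; exact: integral_ge0.
  apply: eq_integral => x _; rewrite integral_std_normal// -ge0_integralZr//.
  - by apply: emeasurable_funM => //; exact: mGx.
  - by move=> y _; rewrite mule_ge0.
have mlin (a b : R) : measurable_fun setT (fun z : R * R => a * z.1 + b * z.2).
  by apply: measurable_funD; apply: measurable_funM.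
pose G (z : R * R) := F (c * z.1 + s * z.2, c * z.2 - s * z.1).
have mG : measurable_fun setT G.
  apply: measurableT_comp => //; apply/measurable_fun_pair => //.
  have -> : (fun z : R * R => c * z.2 - s * z.1) = (fun z =>
    - s * z.1 + c * z.2).
    by apply/funext => z; ring.
  exact: mlin.
have G0 z : (0 <= G z)%E by exact: F0.
rewrite (dbl G mG G0) (dbl F mF F0).
pose J (z : R * R) := (G z * (phi z.2)%:E * (phi z.1)%:E)%E.
have mJ : measurable_fun setT J.
  apply: emeasurable_funM.
    apply: emeasurable_funM => //.
    exact: (measurableT_comp mphi measurable_snd).
  exact: (measurableT_comp mphi measurable_fst).
have J0 z : (0 <= J z)%E by rewrite !mule_ge0.
transitivity (\int[mu]_x \int[mu]_y J (x, y))%E; first by [].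
have -> := fubini_tonelli (m1 := mu) (m2 := mu) J mJ J0.
(* The integrand after taking c x + s y as new first variable at fixed y; |1/c| is the Jacobian
   factor. *)
pose J2 (z : R * R) := (`|c^-1|%:E * J (c^-1 * z.1 - s / c * z.2, z.2)%R)%E.
have mJ2 : measurable_fun setT J2.
  apply: emeasurable_funM => //; apply: measurableT_comp => //.
  apply/measurable_fun_pair => //=.
  have -> : (fun z : R * R => c^-1 * z.1 - s / c * z.2) = (fun z =>
    c^-1 * z.1 + (- (s / c)) * z.2).
    by apply/funext => z; ring.
  exact: mlin.
have J20 z : (0 <= J2 z)%E by rewrite mule_ge0// lee_fin.
have sub1 (y : R) : (\int[mu]_x J (x, y) = \int[mu]_x J2 (x, y))%E.
  have mJy : measurable_fun setT (fun x => J (x, y)).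
    by apply: measurableT_comp => //; exact: measurable_pair2.
  rewrite (@ge0_integral_affine _ c^-1 (- (s / c * y)) _ (fun x => J (x, y)))//;
    last by rewrite invr_eq0.
  rewrite -[LHS]ge0_integralZl//.
    have -> : (fun x => J ((c^-1 * x + - (s / c * y))%R, y)) = (fun x =>
      J (x, y)) \o (fun x => c^-1 * x + - (s / c * y)) by [].
    apply: measurableT_comp => //.
    by apply: measurable_funD => //; exact: measurable_funM.
transitivity (\int[mu]_y \int[mu]_x J2 (x, y))%E.
  by apply: eq_integral => y _; exact: sub1.
have <- := fubini_tonelli (m1 := mu) (m2 := mu) J2 mJ2 J20;
  apply: eq_integral => x _.
have mJ2x : measurable_fun setT (fun y => J2 (x, y)).
  by apply: measurableT_comp => //; exact: measurable_pair1.
(* Second substitution, at fixed new first variable [x]: y becomes c y + s x. Its factor |c| cancels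
   |1/c|, and the two substitutions compose to the inverse rotation. *)
rewrite (@ge0_integral_affine _ c (s * x) c0 (fun y => J2 (x, y)))//.
rewrite -[LHS]ge0_integralZl//; last first.
  have -> : (fun y => J2 (x, (c * y + s * x)%R)) = (fun y =>
    J2 (x, y)) \o (fun y => c * y + s * x) by [].
  apply: measurableT_comp => //.
  by apply: measurable_funD => //; exact: measurable_funM.
apply: eq_integral => y _.
rewrite /J2 /J /G /= muleA -EFinM -normrM divff// normr1 mul1e.
have -> : c^-1 * x - s / c * (c * y + s * x) = c * x - s * y.
  apply: (mulfI c0); transitivity (x - s * c * y - s ^+ 2 * x); first by field.
  by rewrite -(addKr (c ^+ 2) (s ^+ 2)) cs1; ring.
have -> : c * (c * x - s * y) + s * (c * y + s * x) = x.
  by rewrite -[RHS]mul1r -cs1; ring.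
have -> : c * (c * y + s * x) - s * (c * x - s * y) = y.
  by rewrite -[RHS]mul1r -cs1; ring.
rewrite -!muleA -!EFinM; congr (_ * _%:E)%E.
rewrite !std_normal_pdfE mulrACA [RHS]mulrACA -!expRD; congr (_ * expR _).
rewrite -[X in _ = X]mul1r -cs1; ring.
Qed.

End standard_normal.

(** * Rotations and independence for Gaussian vectors *)

Definition RV_of {R : realType} {disp : measure_display}
    {Omega : measurableType disp} {P : probability Omega R} (f : Omega -> R)
    (mf : measurable_fun setT f) : {RV P >-> R} :=
  mfun_Sub (mem_set mf).

Section gaussian_vector.
Context {R : realType} {disp : measure_display} {Omega : measurableType disp}.
Context {P : probability Omega R} {d : nat}.
Implicit Types Z : 'I_d -> {RV P >-> R}.
Local Notation gamma := (@std_normal R).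

Let cyl Z (B : 'I_d -> set R) := [set w | forall i, B i (Z i w)].

Let cylE Z B : cyl Z B = \bigcap_(i in [set: 'I_d]) Z i @^-1` B i.
Proof. by apply/seteqP; split => w h i; [move=> _|]; exact: h. Qed.

Let mcyl Z B : (forall i, measurable (B i)) -> measurable (cyl Z B).
Proof.
move=> mB; rewrite cylE; apply: fin_bigcap_measurable => // i _.
by rewrite -[X in measurable X]setTI; exact: measurable_funP.
Qed.

(** The law on full boxes encodes both marginals and independence: setting [B i] to [setT] outside
    [J] recovers every subfamily. This single product formula is what the rotation argument
    verifies. *)
Lemma standard_gaussian_vectorP Z :
  standard_gaussian_vector Z <->
  (forall B : 'I_d -> set R, (forall i, measurable (B i)) ->
    P [set w | forall i, B i (Z i w)] = (\prod_i gamma (B i))%E).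
Proof.
split=> [[nZ iZ] B mB|ZP].
  have := iZ [set: 'I_d]%SET B mB.
  have -> : [set` [set: 'I_d]%SET] = [set: 'I_d] by apply/seteqP; split => i /=;
    rewrite ?inE.
  rewrite -cylE => ->; apply: eq_big => [i|i _]; first by rewrite inE.
  exact: nZ.
have sub (J : {set 'I_d}) (B : 'I_d -> set R) : (forall i, measurable (B i)) ->
    P (\bigcap_(i in [set` J]) Z i @^-1` B i) = (\prod_(i in J) gamma (B i))%E.
  move=> mB; pose B' i := if i \in J then B i else setT.
  transitivity (P (cyl Z B')).
    congr (P _); apply/seteqP; split => w h i; rewrite /B'.
      by case: ifPn => // iJ; exact: h.
    by move=> /= iJ; have := h i; rewrite /B' iJ.
  rewrite ZP; last by move=> i; rewrite /B'; case: ifP.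
  rewrite [RHS]big_mkcond/=; apply: eq_bigr => i _.
  by rewrite /B'; case: ifP => // _; rewrite probability_setT.
have nZ : forall i, standard_normal (Z i).
  move=> i B mB; have := sub [set i]%SET (fun=> B) (fun=> mB).
  rewrite big_set1 => gB; transitivity (gamma B); last by [].
  rewrite -gB; congr (P _); apply/seteqP; split => w /=.
    by move=> h j; rewrite /= inE => /eqP ->.
  by move=> h; apply: (h i); rewrite /= inE.
split=> // J B mB; rewrite sub//; apply: eq_bigr => i _.
exact/esym/nZ.
Qed.

(** By the box criterion only the plane of [i] and [j] matters. The event [E] collects the
    conditions on the untouched coordinates; restricted to [E], the pair (Z i, Z j) still has a
    multiple of the planar Gaussian law, which [std_normal_rot] leaves invariant. *)
Lemma standard_gaussian_rot Z (i j : 'I_d) (c s : R) :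
  i != j -> c != 0 -> c ^+ 2 + s ^+ 2 = 1 -> standard_gaussian_vector Z ->
  exists Z', [/\ standard_gaussian_vector Z',
    forall w, Z' i w = c * Z i w + s * Z j w,
    forall w, Z' j w = c * Z j w - s * Z i w &
    forall k, k != i -> k != j -> Z' k = Z k].
Proof.
move=> ij c0 cs1 /standard_gaussian_vectorP ZP.
pose f k w := if k == i then c * Z i w + s * Z j w else
  if k == j then c * Z j w - s * Z i w else Z k w.
have mf k : measurable_fun setT (f k).
  rewrite /f; case: (k == i).
    by apply: measurable_funD; apply: measurable_funM.
  case: (k == j) => //.
  by apply: measurable_funB; apply: measurable_funM.
pose Z' k : {RV P >-> R} := RV_of (mf k).
exists Z'; split; last 3 first.
- by move=> w; rewrite /Z' /= /f eqxx.
- by move=> w; rewrite /Z' /= /f eq_sym (negbTE ij) eqxx.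
- by move=> k ki kj; apply/mfuneqP => w;
  rewrite /Z' /= /f (negbTE ki) (negbTE kj).
apply/standard_gaussian_vectorP => B mB.
pose E : set Omega := [set w | forall k, k != i -> k != j -> B k (Z k w)].
pose BE (A1 A2 : set R) k := if k == i then A1 else if k == j then A2 else B k.
have mBE A1 A2 k : measurable A1 -> measurable A2 -> measurable (BE A1 A2 k).
  by rewrite /BE; case: ifP => // _; case: ifP.
have BEE A1 A2 : cyl Z (BE A1 A2) = E `&` (Z i @^-1` A1 `&` Z j @^-1` A2).
  apply/seteqP; split => w.
    move=> h; split.
      by move=> k ki kj; have := h k; rewrite /BE (negbTE ki) (negbTE kj).
    split; first by have := h i; rewrite /BE eqxx.
    by have := h j; rewrite /BE eq_sym (negbTE ij) eqxx.
  move=> [Ew [Aiw Ajw]] k; rewrite /BE; case: eqVneq => [->//|ki].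
  by case: eqVneq => [->//|kj]; exact: Ew.
have mE : measurable E.
  rewrite (_ : E = cyl Z (BE setT setT)); first by apply: mcyl => k; exact: mBE.
  by rewrite BEE !preimage_setT !setIT.
pose q : \bar R := (\prod_(k | (k != i) && (k != j)) gamma (B k))%E.
have prodE A1 A2 : (\prod_k gamma (BE A1 A2 k) = gamma A1 * gamma A2 * q)%E.
  rewrite (bigD1 i)//= (bigD1 j) 1?eq_sym//= muleA.
  rewrite {1 2}/BE eqxx (eq_sym j) (negbTE ij) eqxx; congr (_ * _)%E.
  by apply: eq_bigr => k /andP[ki kj]; rewrite /BE (negbTE ki) (negbTE kj).
have PE : P E = q.
  rewrite (_ : E = cyl Z (BE setT setT));
    last by rewrite BEE !preimage_setT !setIT.
  rewrite ZP; last by move=> k; exact: mBE.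
  by rewrite prodE !probability_setT !mul1e.
have q0 : (0 <= q)%E by rewrite -PE.
have qfin : q \is a fin_num by rewrite -PE fin_num_measure.
pose qq : {nonneg R} := NngNum (fine_ge0 q0).
have qqE : (qq%:num)%:E = q by exact: fineK.
pose ZZ w := (Z i w, Z j w).
have mZZ : measurable_fun setT ZZ by exact/measurable_fun_pair.
(* The law of (Z i, Z j) on the event [E], of total mass [q]. *)
pose m' := pushforward_along mZZ (mrestr P mE).
pose F (z : R * R) : \bar R := (\1_(B i `*` B j) z)%:E.
have mF : measurable_fun setT F.
  by apply/measurable_EFinP/measurable_indic; exact: measurableX.
have F0 z : (0 <= F z)%E by rewrite lee_fin.
pose lin (z : R * R) := (c * z.1 + s * z.2, c * z.2 - s * z.1).
have mlin : measurable_fun setT lin.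
  apply/measurable_fun_pair.
    by apply: measurable_funD; apply: measurable_funM.
  by apply: measurable_funB; apply: measurable_funM.
have mC : measurable (lin @^-1` (B i `*` B j)).
  by rewrite -[X in measurable X]setTI; apply: mlin => //; exact: measurableX.
have -> : P [set w | forall k, B k (Z' k w)] = m' (lin @^-1` (B i `*` B j)).
  congr (P _); apply/seteqP; split => w.
    move=> h; split.
      split; first by have := h i; rewrite /= /f eqxx.
      by have := h j; rewrite /= /f eq_sym (negbTE ij) eqxx.
    by move=> k ki kj; have := h k; rewrite /= /f (negbTE ki) (negbTE kj).
  move=> [[/= h1 h2] Ew] k /=; rewrite /f; case: eqVneq => [->//|ki].
  by case: eqVneq => [->//|kj]; exact: Ew.
(* On rectangles [m'] equals the product of the two Gaussian masses times [q], so it is the product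
   measure with [q] absorbed into the first factor. *)
rewrite -(@product_measure_unique _ _ _ _ _ (mscale qq gamma) gamma m')//;
  last first.
  move=> A1 A2 mA1 mA2.
  have -> : m' (A1 `*` A2) = P (cyl Z (BE A1 A2)).
    by rewrite BEE setIC.
  rewrite ZP; last by move=> k; exact: mBE.
  by rewrite prodE muleC muleA -qqE.
rewrite -[in LHS](setIT (lin @^-1` _)) -integral_indic//.
transitivity (\int[mscale qq gamma \x gamma]_z (F \o lin) z)%E;
  first by apply: eq_integral => z _.
have mFl : measurable_fun setT (F \o lin) by exact: (measurableT_comp mF mlin).
have Fl0 z : (0 <= (F \o lin) z)%E by exact: F0.
rewrite (fubini_tonelli1 _ mFl Fl0).
rewrite /fubini_F ge0_integral_mscale//.
- rewrite qqE (std_normal_rot c0 cs1 mF F0).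
  have -> : (\int[gamma]_x \int[gamma]_y F (x, y) =
    (gamma \x gamma)%E (B i `*` B j))%E.
    rewrite -(setIT (_ `*` _)) -integral_indic//; last exact: measurableX.
    by rewrite fubini_tonelli1.
  rewrite product_measure1E// (bigD1 i)//= (bigD1 j) 1?eq_sym//= muleA.
  by rewrite [LHS]muleC.
- exact: (measurable_fun_fubini_tonelli_F (m2 := gamma) (F \o lin)).
- by move=> x _; exact: integral_ge0.
Qed.
End gaussian_vector.

Lemma std_normal_sym (R : realType) (f : R -> \bar R) :
  measurable_fun setT f -> (forall x, 0 <= f x)%E ->
  (\int[std_normal]_x f (- x)%R = \int[std_normal]_x f x)%E.
Proof.
move=> mf f0; have mfN : measurable_fun setT (fun x : R => f (- x)).
  by apply: measurableT_comp.
have mphi : measurable_fun setT (EFin \o normal_pdf (0 : R) 1).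
  by apply/measurable_EFinP; exact: measurable_normal_pdf.
rewrite !integral_std_normal//.
have N10 : (-1 : R) != 0 by rewrite oppr_eq0 oner_eq0.
rewrite (@ge0_integral_affine _ (-1) 0 N10 (fun x : R =>
  (f (- x)%R * (normal_pdf 0 1 x)%:E)%E)).
- rewrite normrN1 mul1e; apply: eq_integral => x _.
  by rewrite addr0 mulN1r opprK !std_normal_pdfE sqrrN.
- exact: emeasurable_funM.
- by move=> x; rewrite mule_ge0// lee_fin normal_pdf_ge0.
Qed.

(** * Splitting off the component along a unit vector *)

Section gaussian_split.
Context {R : realType} {disp : measure_display} {Omega : measurableType disp}.
Context {P : probability Omega R} {d : nat}.
Implicit Types Z : 'I_d -> {RV P >-> R}.
Local Notation gamma := (@std_normal R).

(* The sign [e] is needed because rotations only reach a vector with a single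
   nonzero coordinate, which is 1 or -1. *)
Lemma gaussian_align n Z (u : 'I_d -> R) (i : 'I_d) :
  standard_gaussian_vector Z -> \sum_k u k ^+ 2 = 1 -> u i != 0 ->
  (#|[pred j | (j != i) && (u j != 0%R)]| <= n)%N ->
  exists Z' (Q : 'I_d -> 'I_d -> R) (e : R), [/\ standard_gaussian_vector Z',
    e ^+ 2 = 1, forall k w, Z k w = \sum_l Z' l w * Q l k &
    forall k, Q i k = e * u k].
Proof.
elim: n Z u => [|n IH] Z u gZ u1 ui.
  rewrite leqn0 => /eqP/card0_eq u0.
  have uj j : j != i -> u j = 0.
    by move=> ji; have := u0 j; rewrite !inE ji /= => /negbFE/eqP.
  exists Z, (fun l k => (l == k)%:R), (u i); split => //.
  - by rewrite -u1 (bigD1 i)//= big1 ?addr0// => j /uj ->; rewrite expr0n.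
  - move=> k w; rewrite (bigD1 k)//= eqxx mulr1 big1 ?addr0// => j jk.
    by rewrite (negbTE jk) mulr0.
  - move=> k; case: eqVneq => [<-|]; last by rewrite eq_sym => /uj ->;
    rewrite mulr0.
    by rewrite -expr2 -u1 (bigD1 i)//= big1 ?addr0// => j /uj ->;
      rewrite expr0n.
case: (pickP [pred j | (j != i) && (u j != 0)]) => [j /= /andP[ji uj] cu|u0 _];
  last first.
  by apply: IH => //; rewrite (eq_card0 u0).
(* The rotation with cosine u_i / r and sine u_j / r moves the weight of coordinate [j] onto [i].
   The new vector [v] has v_i = r and v_j = 0, hence one nonzero coordinate fewer apart from [i]. *)
pose r := Num.sqrt (u i ^+ 2 + u j ^+ 2).
have ui2 : 0 < u i ^+ 2 by rewrite exprn_even_gt0.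
have r2 : r ^+ 2 = u i ^+ 2 + u j ^+ 2.
  by rewrite sqr_sqrtr// addr_ge0// sqr_ge0.
have r0 : r != 0.
  by rewrite gt_eqF// sqrtr_gt0 ltr_wpDr// sqr_ge0.
have ij : i != j by rewrite eq_sym.
have c0 : u i / r != 0 by rewrite mulf_neq0 ?invr_eq0.
have cs1 : (u i / r) ^+ 2 + (u j / r) ^+ 2 = 1.
  by rewrite !expr_div_n -mulrDl -r2 divff// expf_neq0.
have [Z1 [gZ1 Z1i Z1j Z1k]] := standard_gaussian_rot ij c0 cs1 gZ.
pose v k := if k == i then r else if k == j then 0 else u k.
have vi : v i = r by rewrite /v eqxx.
have vj : v j = 0 by rewrite /v (negbTE ji) eqxx.
have vk k : k != i -> k != j -> v k = u k.
  by rewrite /v => /negbTE -> /negbTE ->.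
have [||| Z' [Q [e [gZ' e1 ZQ Qi]]]] := IH Z1 v gZ1.
- rewrite -u1 (bigD1 i)//= (bigD1 j)//= [RHS](bigD1 i)//= [in RHS](bigD1 j)//=.
  rewrite vi vj r2 expr0n add0r -addrA; congr (_ + (_ + _)).
  by apply: eq_bigr => k /andP[ki kj]; rewrite vk.
- by rewrite vi.
- rewrite -ltnS; apply: leq_trans cu; apply: proper_card; apply/properP; split.
    apply/fintype.subsetP => k; rewrite !inE => /andP[ki].
    by rewrite ki /=; case: (eqVneq k j) => [->|kj];
      [rewrite vj eqxx|rewrite vk].
  by exists j; rewrite !inE ?ji ?uj// vj eqxx.
(* Columns [i] and [j] of the new matrix undo the rotation: Z_i and Z_j are recovered from [Z1] by
   the inverse rotation, then expressed through [Z']. *)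
exists Z', (fun l k =>
  if k == i then u i / r * Q l i - u j / r * Q l j else
  if k == j then u j / r * Q l i + u i / r * Q l j else Q l k), e.
split=> // [k w|k].
- case: eqVneq => [->|ki].
    transitivity (u i / r * Z1 i w - u j / r * Z1 j w).
      by rewrite Z1i Z1j -[LHS]mul1r -cs1; ring.
    rewrite !ZQ !mulr_sumr -sumrB; apply: eq_bigr => l _; ring.
  case: eqVneq => [->|kj].
    transitivity (u j / r * Z1 i w + u i / r * Z1 j w).
      by rewrite Z1i Z1j -[LHS]mul1r -cs1; ring.
    rewrite !ZQ !mulr_sumr -big_split; apply: eq_bigr => l _ /=; ring.
  by rewrite -Z1k// ZQ.
- case: eqVneq => [->|ki].
    by rewrite !Qi vi vj; field.
  case: eqVneq => [->|kj].
    by rewrite !Qi vi vj; field.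
  by rewrite Qi vk.
Qed.

Section disintegration.
Variables (Z : 'I_d -> {RV P >-> R}) (i : 'I_d).
Hypothesis gZ : standard_gaussian_vector Z.

(** A family stable under intersection that generates the sigma-algebra of the coordinates other
    than [i]; independence of [Z i] from that sigma-algebra is tested on it. *)
Definition other_cylinders : set (set Omega) :=
  [set E | exists2 B : 'I_d -> set R, (forall k, measurable (B k)) &
     E = [set w | forall k, k != i -> B k (Z k w)]].

Local Notation Omega' := (g_sigma_algebraType other_cylinders).

Let cylT : other_cylinders setT.
Proof. by exists (fun=> setT) => //; apply/seteqP; split. Qed.

Let cylI : setI_closed other_cylinders.
Proof.
move=> _ _ [B mB ->] [C mC ->]; exists (fun k => B k `&` C k).
  by move=> k; exact: measurableI.
apply/seteqP; split => w /=; first by move=> [h1 h2] k ki; split;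
  [exact: h1|exact: h2].
by move=> h; split=> k /h[].
Qed.

Let cyl_measurable : other_cylinders `<=` measurable.
Proof.
move=> _ [B mB ->].
rewrite (_ : [set _ | _] = \bigcap_(k in [set k | k != i]) Z k @^-1` B k)//.
apply: fin_bigcap_measurable => [|k _]; first exact: finite_finset.
by rewrite -[X in measurable X]setTI; exact: measurable_funP.
Qed.

Let measurable_id' : measurable_fun setT (id : Omega -> Omega').
Proof.
by move=> _ E mE; rewrite setTI;
  exact: (smallest_sub (@sigma_algebra_measurable _ Omega) cyl_measurable).
Qed.

Lemma other_coord_measurable k : k != i ->
  measurable_fun [set: Omega'] (Z k : Omega' -> R).
Proof.
move=> ki _ B mB; rewrite setTI; apply: sub_sigma_algebra.
exists (fun l => if l == k then B else setT); first by move=> l; case: ifP.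
apply/seteqP; split => w /=.
  by move=> Bw l li; case: eqVneq => // ->.
by move=> /(_ k ki); rewrite eqxx.
Qed.

(** For fixed [A] both sides are finite measures in [E]. They agree on the cylinders, a family
    stable under intersection, hence on the generated sigma-algebra. *)
Let indep (A : set R) (E : set Omega) : measurable A ->
  <<s other_cylinders >> E ->
  P (Z i @^-1` A `&` E) = (gamma A * P E)%E.
Proof.
move=> mA sE.
have mZA : measurable (Z i @^-1` A).
  by rewrite -[X in measurable X]setTI; exact: measurable_funP.
have gA : gamma A \is a fin_num by rewrite fin_num_measure.
pose q : {nonneg R} := NngNum (fine_ge0 (measure_ge0 gamma A)).
have qE : (q%:num)%:E = gamma A by exact: fineK.
rewrite setIC -qE.
apply: (@g_sigma_algebra_measure_unique _ _ _ other_cylinders cyl_measurable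
  (fun=> setT) _ _ (mrestr P mZA) (mscale q P)) => //.
- by rewrite bigcup_const//; exists 0%N.
- move=> _ [B mB ->]; rewrite /mrestr.
  transitivity (gamma A * P [set w | forall k, k != i -> B k (Z k w)])%E;
    last first.
    by rewrite -qE.
  (* Used twice: [A' = A] gives the joint probability, [A' = setT] the probability of the cylinder
     alone. *)
  pose C A' k := if k == i then A' else B k.
  have CE A' : measurable A' ->
    P ([set w | forall k, k != i -> B k (Z k w)] `&` Z i @^-1` A') =
    (gamma A' * \prod_(k | k != i) gamma (B k))%E.
    move=> mA'; transitivity (P [set w | forall k, C A' k (Z k w)]).
      congr (P _); apply/seteqP; split => w /=.
        move=> [h1 h2] k; rewrite /C; case: eqVneq => [->//|ki]; exact: h1.
      move=> h; split=> [k ki|]; first by have := h k; rewrite /C (negbTE ki).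
      by have := h i; rewrite /C eqxx.
    have /standard_gaussian_vectorP -> := gZ; last first.
      by move=> k; rewrite /C; case: ifP.
    rewrite (bigD1 i)//= {1}/C eqxx; congr (_ * _)%E.
    by apply: eq_bigr => k ki; rewrite /C (negbTE ki).
  rewrite [LHS](CE A mA); congr (_ * _)%E.
  rewrite -[X in _ = P X]setIT -(preimage_setT (Z i)) [RHS]CE//.
  by rewrite probability_setT mul1e.
- move=> k; apply: le_lt_trans (ltry (1 : R)); apply: probability_le1.
  exact: measurableI.
Qed.

(* [Z i] is independent of the sigma-algebra of [Omega'], generated by the other
   coordinates, so its occurrence in [F] can be integrated out first. *)
Lemma gaussian_disintegration (F : R * Omega' -> \bar R) :
  measurable_fun setT F -> (forall z, 0 <= F z)%E ->
  (\int[P]_w F (Z i w, w) = \int[gamma]_s \int[P]_w F (s, w))%E.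
Proof.
move=> mF F0.
pose X : {RV P >-> Omega'} := mfun_Sub (mem_set measurable_id').
have mJ : measurable_fun setT (fun w => (Z i w, w : Omega')).
  by apply/measurable_fun_pair.
pose J : {RV P >-> (R * Omega')%type} := mfun_Sub (mem_set mJ).
transitivity (\int[distribution P J]_z F z)%E.
  by rewrite ge0_integral_distribution.
transitivity (\int[gamma \x distribution P X]_z F z)%E.
  apply/esym; apply: eq_measure_integral => A mA _.
  by apply: product_measure_unique => // A1 A2 mA1 mA2; exact: indep.
rewrite fubini_tonelli1//; apply: eq_integral => s _.
rewrite /fubini_F ge0_integral_distribution//.
by apply: measurableT_comp => //; exact: measurable_pair1.
Qed.

End disintegration.

Lemma measurable_line (u : 'rV[R]_d) (W : Omega -> 'rV[R]_d)
    (f : 'rV[R]_d -> R) (g : R -> R) :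
  continuous f -> measurable_fun setT g ->
  (forall k, measurable_fun setT (fun w => W w 0 k)) ->
  measurable_fun setT (fun z : R * Omega => (g (f (z.1 *: u + W z.2)))%:E).
Proof.
move=> cf mg mW; apply/measurable_EFinP; apply: (measurableT_comp mg).
apply: (measurable_continuous_row (X := fun z : R * Omega =>
  z.1 *: u + W z.2)) => // k.
under eq_fun do rewrite mxE mxE.
apply: measurable_funD; last exact: (measurableT_comp (mW k) measurable_snd).
exact: measurable_funM.
Qed.

(** After aligning [u] with coordinate [i], [W] gathers the contributions of the other rotated
    coordinates. The iterated integral expresses that [W] is independent of the component along [u].
    In the test function g(f(.)), continuity of [f] provides measurability on row vectors. *)
Lemma gaussian_split Z (u : 'rV[R]_d) :
  standard_gaussian_vector Z -> \sum_k u 0 k ^+ 2 = 1 ->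
  exists W : Omega -> 'rV[R]_d,
    (forall k, measurable_fun setT (fun w => W w 0 k)) /\
    forall (f : 'rV[R]_d -> R) (g : R -> R),
      continuous f -> measurable_fun setT g -> (forall x, 0 <= g (f x)) ->
      (\int[P]_w (g (f (rvec Z w)))%:E =
       \int[gamma]_s \int[P]_w (g (f (s *: u + W w)))%:E)%E.
Proof.
move=> gZ u1.
have [i ui] : exists i, u 0 i != 0.
  apply/existsP; apply: contraT; rewrite negb_exists => /forallP u0.
  move: u1; rewrite big1 => [/esym/eqP|k _]; first by rewrite oner_eq0.
  by have := u0 k; rewrite negbK => /eqP ->; rewrite expr0n.
have [Z' [Q [e [gZ' e1 ZQ Qi]]]] := gaussian_align gZ u1 ui (leqnn _).
pose W w : 'rV[R]_d := \row_k \sum_(l | l != i) Z' l w * Q l k.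
have mW k : measurable_fun [set: g_sigma_algebraType (other_cylinders Z' i)]
    ((fun w => W w 0 k) : g_sigma_algebraType (other_cylinders Z' i) -> R).
  under eq_fun do rewrite mxE big_mkcond/=.
  apply: measurable_sum => l; case: (boolP (l == i)) => //= li.
  by apply: measurable_funM => //; exact: other_coord_measurable.
have eE : e = 1 \/ e = -1.
  by have := sqrf_eq1 e; rewrite e1 eqxx => /esym/orP[]/eqP; [left|right].
have mW' k : measurable_fun [set: Omega] (fun w => W w 0 k).
  have -> : (fun w => W w 0 k) = (fun w =>
    \sum_l if l != i then Z' l w * Q l k else 0).
    by apply/funext => w; rewrite mxE big_mkcond.
  apply: measurable_sum => l; case: (l != i); last exact: measurable_cst.
  exact: measurable_funM.
exists W; split=> // f g cf mg G0; pose G := g \o f.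
pose V (z : R * g_sigma_algebraType (other_cylinders Z' i)) :=
  (e * z.1) *: u + W z.2.
have mGV : measurable_fun setT (G \o V).
  apply: (measurableT_comp mg (measurable_continuous_row (X := V) _ cf)) => k;
    rewrite /V.
  under eq_fun do rewrite mxE mxE.
  apply: measurable_funD; last exact: (measurableT_comp (mW k) measurable_snd).
  by apply: measurable_funM => //; exact: measurable_funM.
have mGVE : measurable_fun setT (EFin \o (G \o V)) by exact/measurable_EFinP.
have -> : (\int[P]_w (g (f (rvec Z w)))%:E =
  \int[P]_w (EFin \o (G \o V)) (Z' i w, w))%E.
  apply: eq_integral => w _; congr (g (f _))%:E; apply/rowP => k.
  rewrite !mxE ZQ (bigD1 i)//= Qi; congr (_ + _); ring.
have GV0 z : (0 <= (EFin \o (G \o V)) z)%E by rewrite lee_fin; exact: G0.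
rewrite (gaussian_disintegration gZ' mGVE GV0).
case: eE => eE.
  apply: eq_integral => s _; apply: eq_integral => w _.
  by rewrite /G /V /= eE mul1r.
pose H (z : R * Omega) := (g (f (z.1 *: u + W z.2)))%:E.
have H0 z : (0 <= H z)%E by rewrite lee_fin; exact: G0.
have mf := measurable_fun_fubini_tonelli_F (m2 :=
  P) H (measurable_line u cf mg mW') H0.
(* When e = -1 the component along [u] enters with reversed sign, which the symmetry of the Gaussian
   law absorbs. *)
rewrite -[RHS](std_normal_sym mf); last by move=> s; exact: integral_ge0.
apply: eq_integral => s _; apply: eq_integral => w _.
by rewrite /H /G /V /= eE mulN1r.
Qed.

End gaussian_split.

(** * Support functions and the Hausdorff distance *)

Lemma lipschitz_continuous_real (R : realType) (V : normedModType R) (f : V ->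
  R) (C : R) :
  (forall x y, f x - f y <= C * `|x - y|) -> continuous f.
Proof.
move=> fC x; apply/cvgrPdist_lt => e e0.
(* [C] may vanish or be negative; |C| + 1 is a positive Lipschitz constant, safe to divide by. *)
have C1 : 0 < `|C| + 1 by rewrite ltr_wpDl.
near=> y.
have xy : `|x - y| < e / (`|C| + 1).
  near: y; apply: (@cvgr_dist_lt _ _ _ (nbhs x) _ id x cvg_id).
  by rewrite divr_gt0.
have le z t : f z - f t <= (`|C| + 1) * `|z - t|.
  rewrite (le_trans (fC z t))// ler_wpM2r// (le_trans (ler_norm C))// lerDl//.
rewrite ltr_pdivlMr// mulrC in xy.
rewrite (le_lt_trans _ xy)// ler_norml le lerNl opprB andbT.
by rewrite (le_trans (le y x))// distrC.
Unshelve. all: by end_near. Qed.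

Section euclidean.
Context {R : realType} {d : nat}.
Implicit Types (x y z u v : 'rV[R]_d) (A B K L : set 'rV[R]_d).

Lemma dotpC x y : dotp x y = dotp y x.
Proof. by apply: eq_bigr => i _; rewrite mulrC. Qed.

Lemma dotpDl x y z : dotp (x + y) z = dotp x z + dotp y z.
Proof. by rewrite /dotp -big_split; apply: eq_bigr => i _;
  rewrite mxE mulrDl. Qed.

Lemma dotpZl (a : R) x y : dotp (a *: x) y = a * dotp x y.
Proof. by rewrite /dotp mulr_sumr; apply: eq_bigr => i _;
  rewrite mxE mulrA. Qed.

Lemma dotpNl x y : dotp (- x) y = - dotp x y.
Proof. by rewrite -scaleN1r dotpZl mulN1r. Qed.

Lemma dotpDr x y z : dotp x (y + z) = dotp x y + dotp x z.
Proof. by rewrite dotpC dotpDl !(dotpC x). Qed.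

Lemma dotpZr (a : R) x y : dotp x (a *: y) = a * dotp x y.
Proof. by rewrite dotpC dotpZl dotpC. Qed.

Lemma dotpNr x y : dotp x (- y) = - dotp x y.
Proof. by rewrite dotpC dotpNl dotpC. Qed.

Lemma dotp_ge0 x : 0 <= dotp x x.
Proof. by apply: sumr_ge0 => i _; rewrite -expr2 sqr_ge0. Qed.

Lemma dotp_eq0 x : dotp x x = 0 -> x = 0.
Proof.
move=> x0; apply/rowP => i; rewrite mxE; apply/eqP.
have /psumr_eq0P h : forall i : 'I_d, true -> 0 <= x 0 i * x 0 i.
  by move=> k _; rewrite -expr2 sqr_ge0.
by have /eqP := h x0 i isT; rewrite mulf_eq0 orbb.
Qed.

Lemma row_coord_le x i : `|x 0 i| <= `|x|.
Proof.
rewrite [`|x|]mx_normrE.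
by apply: (@le_bigmax _ _ _ 0 (fun ij : 'I_1 * 'I_d => `|x ij.1 ij.2|) (0, i)).
Qed.

(** Compares the inner product with the max norm, which carries the topology. The crude factor [d]
    only enters continuity and finiteness arguments, never the final constant. *)
Lemma dotp_le x y : dotp x y <= d%:R * (`|x| * `|y|).
Proof.
have -> : d%:R * (`|x| * `|y|) = \sum_(i < d) `|x| * `|y|.
  by rewrite sumr_const card_ord mulr_natl.
apply: ler_sum => i _.
rewrite (le_trans (ler_norm _))// normrM ler_pM// row_coord_le//.
Qed.

Lemma enorm_ge0 x : 0 <= enorm x. Proof. exact: sqrtr_ge0. Qed.

Lemma enorm_sqr x : enorm x ^+ 2 = dotp x x.
Proof. by rewrite sqr_sqrtr// dotp_ge0. Qed.

Lemma cauchy_schwarz x y : dotp x y <= enorm x * enorm y.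
Proof.
apply: le_trans (ler_norm _) _.
rewrite -(@ler_pXn2r _ 2)// ?nnegrE ?mulr_ge0 ?enorm_ge0//.
rewrite exprMn !enorm_sqr real_normK ?num_real//.
have [/dotp_eq0 ->|y0] := eqVneq (dotp y y) 0.
  by rewrite -(scale0r y) dotpZr mul0r expr0n mulr_ge0// dotp_ge0.
have yy : 0 < dotp y y by rewrite lt_def y0 dotp_ge0.
(* This vector is <y,y> times the part of [x] orthogonal to [y]; its squared length is c (a c -
   b^2). *)
have := dotp_ge0 (dotp y y *: x - dotp x y *: y).
rewrite dotpDl !dotpDr !dotpNl !dotpNr !dotpZl !dotpZr (dotpC y x).
set a := dotp x x; set b := dotp x y; set c := dotp y y.
set D := (X in 0 <= X); have -> : D = c * (a * c - b ^+ 2) by rewrite /D; ring.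
by rewrite pmulr_rge0// subr_ge0.
Qed.

Lemma enorm_triangle x y : enorm (x + y) <= enorm x + enorm y.
Proof.
rewrite -(@ler_pXn2r _ 2)// ?nnegrE ?addr_ge0 ?enorm_ge0//.
rewrite sqrrD !enorm_sqr dotpDl !dotpDr (dotpC y x).
have := cauchy_schwarz x y; lra.
Qed.

Lemma enorm_le x : enorm x <= Num.sqrt d%:R * `|x|.
Proof.
rewrite -(@ler_pXn2r _ 2)// ?nnegrE ?mulr_ge0 ?enorm_ge0 ?sqrtr_ge0//.
by rewrite enorm_sqr exprMn sqr_sqrtr// expr2 dotp_le.
Qed.

Lemma enorm_dist x y : enorm x - enorm y <= enorm (x - y).
Proof. by rewrite lerBlDr -{1}(subrK y x) enorm_triangle. Qed.

Lemma continuous_enormB z : continuous (fun x => enorm (z - x)).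
Proof.
apply: (@lipschitz_continuous_real _ _ _ (Num.sqrt d%:R)) => x y.
rewrite (le_trans (enorm_dist _ _))// (le_trans (enorm_le _))//.
rewrite (_ : z - x - (z - y) = - (x - y)) ?normrN//.
by apply/rowP => i; rewrite !mxE; ring.
Qed.

Section support.
Variables (A : set 'rV[R]_d) (C : R).
Hypotheses (A0 : A !=set0) (AC : forall y, A y -> `|y| <= C).

Let bound x : ubound [set dotp x y | y in A] (d%:R * (`|x| * C)).
Proof.
move=> _ [y Ay <-]; rewrite (le_trans (dotp_le _ _))//.
by rewrite !ler_wpM2l// AC.
Qed.

Lemma support_fun_ge x y : A y -> dotp x y <= support_fun A x.
Proof.
by move=> Ay; apply: ub_le_sup; [exists (d%:R * (`|x| * C))|exists y].
Qed.

Lemma support_fun_le x (c : R) : (forall y, A y -> dotp x y <= c) ->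
  support_fun A x <= c.
Proof.
move=> h; apply: ge_sup; first by have [y Ay] := A0; exists (dotp x y), y.
by move=> _ [y Ay <-]; exact: h.
Qed.

Lemma support_funD x y : support_fun A (x + y) <= support_fun A x + support_fun
  A y.
Proof.
apply: support_fun_le => z Az; rewrite dotpDl.
by apply: lerD; exact: support_fun_ge.
Qed.

Lemma support_funZ (s : R) x : 0 <= s ->
  support_fun A (s *: x) <= s * support_fun A x.
Proof.
move=> s0; apply: support_fun_le => z Az; rewrite dotpZl.
by rewrite ler_wpM2l// support_fun_ge.
Qed.

Lemma support_fun_norm x : support_fun A x <= d%:R * C * `|x|.
Proof.
by apply: support_fun_le => y Ay; rewrite -mulrA (mulrC C); apply: bound;
  exists y.
Qed.

Lemma support_fun_lip x y : support_fun A x - support_fun A y <= d%:R * C * `|x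
  - y|.
Proof.
rewrite lerBlDr (le_trans _ (lerD (support_fun_norm _) (lexx _)))//.
by rewrite -{1}(subrK y x) support_funD.
Qed.

Lemma continuous_support_fun : continuous (support_fun A).
Proof. exact: lipschitz_continuous_real support_fun_lip. Qed.

Lemma support_fun_abs x : `|support_fun A x| <= d%:R * C * `|x|.
Proof.
rewrite ler_norml support_fun_norm andbT lerNl.
have [y Ay] := A0; rewrite -normrN.
apply: le_trans (support_fun_norm (- x)).
rewrite (@le_trans _ _ (dotp (- x) y))//; last exact: support_fun_ge.
by rewrite dotpNl lerN2 support_fun_ge.
Qed.

End support.

Lemma compact_norm_bounded A : compact A -> exists C, forall y, A y -> `|y|
  <= C.
Proof.
move=> /compact_bounded [M [_ h]]; exists (M + 1) => y Ay.
by apply: (h (M + 1)) => //; rewrite ltrDl.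
Qed.

Lemma convex_rowP A x y (t : R) :
  convex_set (A : set (convex_lmodType 'rV[R]_d)) -> A x -> A y ->
  0 <= t <= 1 -> A (t *: x + (1 - t) *: y).
Proof.
move=> cA Ax Ay t01.
have := cA x y (Itv01 (proj1 (andP t01)) (proj2 (andP t01))).
by rewrite !inE; apply.
Qed.

Lemma nearest_point A x : A !=set0 -> compact A ->
  exists z, [/\ A z, dist_to x A = enorm (x - z) &
    forall y, A y -> enorm (x - z) <= enorm (x - y)].
Proof.
move=> A0 cA.
have [|z] := compact_EVT_min A0 cA (f := fun y => enorm (x - y)).
  by apply: continuous_subspaceT; exact: continuous_enormB.
rewrite inE => Az zmin; exists z; split => //; last first.
  by move=> y Ay; apply: zmin; rewrite inE.
apply/eqP; rewrite eq_le; apply/andP; split.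
  by apply: ge_inf; [exists 0 => _ [y _ <-]; exact: enorm_ge0|exists z].
apply: lb_le_inf; first by exists (enorm (x - z)), z.
by move=> _ [y Ay <-]; apply: zmin; rewrite inE.
Qed.

(** Moving from [z] a fraction [t] towards [y] stays in [A] and changes the squared distance to [x]
    by t (t N - 2 q). Minimality makes this nonnegative on [0, 1], which excludes q > 0. *)
Lemma nearest_point_obtuse A x z :
  convex_set (A : set (convex_lmodType 'rV[R]_d)) -> A z ->
  (forall y, A y -> enorm (x - z) <= enorm (x - y)) ->
  forall y, A y -> dotp (x - z) y <= dotp (x - z) z.
Proof.
move=> cA Az zmin y Ay; rewrite -subr_le0 -dotpNr -dotpDr.
set q := dotp (x - z) (y - z); set N := dotp (y - z) (y - z).
have N0 : 0 <= N by exact: dotp_ge0.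
have key t : 0 <= t <= 1 -> 0 <= t * (t * N - 2 * q).
  move=> t01; have := zmin _ (convex_rowP cA Ay Az t01).
  rewrite -(@ler_pXn2r _ 2)// ?nnegrE ?enorm_ge0// !enorm_sqr.
  have -> : x - (t *: y + (1 - t) *: z) = (x - z) - t *: (y - z).
    by apply/rowP => i; rewrite !mxE; ring.
  rewrite -subr_ge0; set D := (X in 0 <= X).
  suff -> : D = t * (t * N - 2 * q) by [].
  rewrite /D /N /q; move: (x - z) (y - z) => a b.
  rewrite dotpDl !dotpDr !dotpNl !dotpNr !dotpZl !dotpZr (dotpC b a); ring.
rewrite leNgt; apply/negP => q0.
(* The contradiction comes from t = q / N, where t N - 2 q = - q, or from t = 1 if that quotient is
   not below 1 or N = 0. *)
have [Nq|qN] := leP N q.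
  by have := key 1; rewrite ler01 lexx => /(_ isT); rewrite !mul1r; lra.
have N1 : 0 < N by exact: lt_trans qN.
have t1 : 0 <= q / N <= 1.
  by apply/andP; split;
    [rewrite divr_ge0// ltW|rewrite ler_pdivrMr// mul1r ltW].
have := key _ t1; rewrite divfK ?gt_eqF//.
have : 0 < q / N by rewrite divr_gt0.
by nra.
Qed.

Lemma dist_to_le A x y : A y -> dist_to x A <= enorm (x - y).
Proof.
by move=> Ay; apply: ge_inf; [exists 0 => _ [z _ <-];
  exact: enorm_ge0|exists y].
Qed.

Lemma continuous_dist_to A : A !=set0 -> compact A ->
  continuous (fun x => dist_to x A).
Proof.
move=> A0 cA; apply: (@lipschitz_continuous_real _ _ _ (Num.sqrt d%:R)) => x y.
have [z [Az -> _]] := nearest_point y A0 cA.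
rewrite lerBlDr (le_trans (dist_to_le _ Az))//.
rewrite -(subrKA y) (le_trans (enorm_triangle _ _))// lerD2r.
exact: enorm_le.
Qed.

Lemma farthest_point K L : K !=set0 -> compact K -> L !=set0 -> compact L ->
  exists x, [/\ K x, sup [set dist_to y L | y in K] = dist_to x L &
    forall y, K y -> dist_to y L <= dist_to x L].
Proof.
move=> K0 cK L0 cL.
have [|x] := compact_EVT_max K0 cK (f := fun y => dist_to y L).
  by apply: continuous_subspaceT; exact: continuous_dist_to.
rewrite inE => Kx xmax; exists x.
have h y : K y -> dist_to y L <= dist_to x L by move=> Ky; apply: xmax;
  rewrite inE.
split => //; apply/eqP; rewrite eq_le; apply/andP; split.
  by apply: ge_sup => [|_ [y Ky <-]]; [exists (dist_to x L), x|exact: h].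
by apply: ub_le_sup; [exists (dist_to x L) => _ [y Ky <-]; exact: h|exists x].
Qed.

(** The direction is the normalized x - z with [z] the nearest point of [L]: <x - z, y> is at most
    <x - z, z> = <x - z, x> - |x - z|^2 on [L]. *)
Lemma separating_direction L x : convex_body L -> 0 < dist_to x L ->
  exists2 u, dotp u u = 1 & support_fun L u + dist_to x L <= dotp u x.
Proof.
move=> [L0 cL vL]; have [z [Lz -> zmin]] := nearest_point x L0 cL => xz.
exists ((enorm (x - z))^-1 *: (x - z)).
  rewrite dotpZl dotpZr -enorm_sqr expr2; field; exact: lt0r_neq0.
rewrite -lerBrDr; apply: (support_fun_le L0) => y Ly.
rewrite lerBrDr !dotpZl -(ler_pM2l xz) mulrDr !mulVKf ?gt_eqF//.
rewrite -expr2 enorm_sqr.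
have := nearest_point_obtuse vL Lz zmin Ly.
have -> : dotp (x - z) (x - z) = dotp (x - z) x - dotp (x - z) z.
  by rewrite [in LHS]dotpDr dotpNr.
lra.
Qed.

Lemma dist_to_gt0 L x : L !=set0 -> compact L -> ~ L x -> 0 < dist_to x L.
Proof.
move=> L0 cL; have [z [Lz -> _]] := nearest_point x L0 cL => nLx.
rewrite lt_def enorm_ge0 andbT; apply/eqP => xz; apply: nLx.
suff /eqP : x - z = 0 by rewrite subr_eq0 => /eqP ->.
by apply: dotp_eq0; rewrite -enorm_sqr xz expr0n.
Qed.

(** Compactness gives a farthest point in each body; the larger of the two distances is the
    Hausdorff distance, and that point is separated from the other body. Since K and L differ, one
    of them has a point outside the other, at positive distance. *)
Lemma hausdorff_direction K L : convex_body K -> convex_body L -> K <> L ->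
  0 < hausdorff_dist K L /\
  exists u x, dotp u u = 1 /\
   ((K x /\ support_fun L u + hausdorff_dist K L <= dotp u x) \/
    (L x /\ support_fun K u + hausdorff_dist K L <= dotp u x)).
Proof.
move=> bK bL KL; have [K0 cK _] := bK; have [L0 cL _] := bL.
have [x [Kx xE xmax]] := farthest_point K0 cK L0 cL.
have [y [Ly yE ymax]] := farthest_point L0 cL K0 cK.
have hE : hausdorff_dist K L = Num.max (dist_to x L) (dist_to y K).
  by rewrite /hausdorff_dist xE yE.
have h0 : 0 < hausdorff_dist K L.
  rewrite hE lt_max; apply/orP.
  have [KsubL|/existsNP[z /not_implyP[Kz nLz]]] := pselect (K `<=` L);
    last first.
    by left; exact: lt_le_trans (dist_to_gt0 L0 cL nLz) (xmax _ Kz).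
  have [LsubK|/existsNP[z /not_implyP[Lz nKz]]] := pselect (L `<=` K);
    last first.
    by right; exact: lt_le_trans (dist_to_gt0 K0 cK nKz) (ymax _ Lz).
  by exfalso; apply: KL; apply/seteqP.
split => //.
have [yx|xy] := leP (dist_to y K) (dist_to x L).
  have hx : hausdorff_dist K L = dist_to x L by rewrite hE max_l.
  have [|u u1 ux] := @separating_direction L x bL; first by rewrite -hx.
  by exists u, x; split => //; left; rewrite hx.
have hy : hausdorff_dist K L = dist_to y K by rewrite hE max_r// ltW.
have [|u u1 uy] := @separating_direction K y bK; first by rewrite -hy.
by exists u, y; split => //; right; rewrite hy.
Qed.

Lemma closed_convex_hull_sub A : A `<=` closed_convex_hull A.
Proof. exact: sub_gen_smallest. Qed.

(** The max-norm ball of radius [C] is closed and convex, hence one of the sets intersected to form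
    the hull. *)
Lemma closed_convex_hull_bounded A (C : R) :
  (forall y, A y -> `|y| <= C) -> forall y, closed_convex_hull A y -> `|y| <= C.
Proof.
move=> AC; apply: (@smallest_sub _ _ _ [set y | `|y| <= C]) => //; split.
  have -> : [set y | `|y| <= C] = (fun y : 'rV[R]_d => `|y|) @^-1` [set r |
    r <= C] by [].
  by apply: closed_comp => [y _|]; [exact: norm_continuous|exact: closed_le].
move=> x y t; rewrite !inE /= => xC yC.
apply: le_trans (ler_normD _ _) _.
have t1 : 0 <= 1 - t%:num by rewrite subr_ge0.
have -> : C = t%:num * C + (1 - t%:num) * C by rewrite -mulrDl subrKC mul1r.
by apply: lerD; rewrite normrZ ger0_norm// ler_wpM2l.
Qed.

End euclidean.

(** * Moments *)

(** Young's inequality for [x] and m^(p-1) with conjugate exponents p and q = p / (p - 1), since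
    m^(p-1) to the power q is m^p. For p = 1, where q would be infinite, both sides coincide. *)
Lemma powR_tangent (R : realType) (p m x : R) : 1 <= p -> 0 < m -> 0 <= x ->
  m `^ p + p * m `^ (p - 1) * (x - m) <= x `^ p.
Proof.
move=> p1 m0 x0.
have mp : m * m `^ (p - 1) = m `^ p by rewrite mulr_powRB1 ?(ltW m0)//
  (lt_le_trans ltr01).
have [p1'|pn1] := eqVneq p 1.
  by rewrite p1' subrr powRr0 !powRr1 ?(ltW m0)//; lra.
have p1' : 1 < p by rewrite lt_neqAle eq_sym pn1.
have p0 : 0 < p by lra.
pose q := p / (p - 1).
have p10 : 0 < p - 1 by lra.
have q0 : 0 < q by rewrite divr_gt0.
have pq : p^-1 + q^-1 = 1.
  by rewrite /q; field; rewrite !gt_eqF.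
have := @conjugate_powR R x (m `^ (p - 1)) p q x0 (powR_ge0 _ _) p0 q0 pq.
have -> : (m `^ (p - 1)) `^ q = m `^ p.
  by rewrite -powRrM; congr (_ `^ _); rewrite /q; field; rewrite gt_eqF.
rewrite -(ler_pM2l p0).
have -> : p * (x `^ p / p + m `^ p / q) = x `^ p + (p - 1) * m `^ p.
  by rewrite /q; field; rewrite !gt_eqF.
rewrite -mp; lra.
Qed.

Section moments.
Context {R : realType}.
Local Notation gamma := (@std_normal R).
Local Notation mu := (@lebesgue_measure R).
Local Notation phi := (normal_pdf (0 : R) (1 : R)).
Variables (p : R) (p1 : 1 <= p).

Let pos (x : R) : R := Num.max x 0.

Let p_gt0 : 0 < p. Proof. exact: lt_le_trans ltr01 p1. Qed.

Lemma measurable_pospart_powR disp (T : measurableType disp) (f : T -> R) :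
  measurable_fun setT f ->
  measurable_fun setT (fun x => ((pos (f x)) `^ p)%:E).
Proof.
move=> mf; apply/measurable_EFinP.
apply: (measurableT_comp (measurable_powR p)).
exact: measurable_maxr.
Qed.

(** Symmetry folds the moment onto the half line, where the shifted moment also lives; 0^p = 0 lets
    the two positive parts add up to |x|^p. *)
Lemma abs_powR_moment_pos :
  (\int[gamma]_x (`|x| `^ p)%:E = 2%:E * \int[gamma]_x ((pos x) `^ p)%:E)%E.
Proof.
have mp : measurable_fun setT (fun x => ((pos x) `^ p)%:E).
  exact: measurable_pospart_powR.
have p0 x : (0 <= ((pos x) `^ p)%:E)%E by rewrite lee_fin powR_ge0.
have -> : (2%:E = 1 + 1 :> \bar R)%E by rewrite -EFinD.
rewrite ge0_muleDl// mul1e.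
rewrite -[X in (_ = X + _)%E](std_normal_sym mp)//.
have mpN : measurable_fun setT (fun x : R => ((pos (- x)) `^ p)%:E).
  exact: measurable_pospart_powR.
rewrite -ge0_integralD//.
apply: eq_integral => x _; rewrite -EFinD /pos; congr EFin.
have [x0|x0] := leP 0 x.
  by rewrite ger0_norm// (max_r (x := - x)) ?oppr_le0// powR0 ?gt_eqF// add0r.
rewrite ltr0_norm// max_l ?oppr_ge0 ?(ltW x0)//.
by rewrite powR0 ?addr0// gt_eqF.
Qed.

(** Shifting by [a] on the right and scaling by sqrt 2 on the left turns the densities into
    exp(-(x+a)^2/2) and exp(-x^2), so the integrands compare pointwise by (x+a)^2 <= 2 x^2 + 2
    a^2. *)
Lemma shifted_moment_ge (a : R) :
  (((1 / 4 * expR (- a ^+ 2)) `^ p)%:E * \int[gamma]_x (`|x| `^ p)%:E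
   <= \int[gamma]_x ((pos (x - a)) `^ p)%:E)%E.
Proof.
have mp : measurable_fun setT (fun x : R => ((pos x) `^ p)%:E).
  exact: measurable_pospart_powR.
have mpa : measurable_fun setT (fun x : R => ((pos (x - a)) `^ p)%:E).
  by apply: measurable_pospart_powR; exact: measurable_funB.
have mphi : measurable_fun setT (EFin \o phi).
  by apply/measurable_EFinP; exact: measurable_normal_pdf.
have phi0 x : 0 <= phi x by exact: normal_pdf_ge0.
have p0 (x : R) : (0 <= ((pos x) `^ p)%:E)%E by rewrite lee_fin powR_ge0.
have N10 : (1 : R) != 0 by rewrite oner_eq0.
pose r2 := Num.sqrt (2 : R).
have r2gt0 : 0 < r2 by rewrite sqrtr_gt0.
have r22 : r2 ^+ 2 = 2 by rewrite sqr_sqrtr.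
have r2n0 : r2 != 0 by rewrite gt_eqF.
rewrite abs_powR_moment_pos !integral_std_normal//.
pose h (x : R) := (((pos x) `^ p)%:E * (phi x)%:E)%E.
have mh : measurable_fun setT h by exact: emeasurable_funM.
have h0 x : (0 <= h x)%E by rewrite mule_ge0// lee_fin.
pose g (x : R) := (((pos (x - a)) `^ p)%:E * (phi x)%:E)%E.
have mg : measurable_fun setT g by exact: emeasurable_funM.
have g0 x : (0 <= g x)%E by rewrite mule_ge0// lee_fin.
rewrite -/g -/h (@ge0_integral_affine _ 1 a N10 g mg g0).
rewrite (@ge0_integral_affine _ r2 0 r2n0 h mh h0).
rewrite normr1 mul1e gtr0_norm//.
have mhr : measurable_fun setT (fun x : R => h (r2 * x + 0)).
  apply: (measurableT_comp mh); apply: measurable_funD;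
    last exact: measurable_cst.
  by apply: measurable_funM.
rewrite !muleA -!EFinM -ge0_integralZl//; last first.
  by rewrite lee_fin !mulr_ge0// ?powR_ge0// ltW.
apply: ge0_le_integral => //.
- by move=> x _; rewrite mule_ge0// lee_fin !mulr_ge0// ?powR_ge0// ltW.
- by apply: emeasurable_funM.
- apply: (measurableT_comp mg); apply: measurable_funD;
  last exact: measurable_cst.
  by apply: measurable_funM.
move=> x _; rewrite /h /g /pos addr0 (mul1r x) addrK -!EFinM lee_fin.
have [x0|x0] := leP x 0.
  by rewrite !max_r ?mulr_ge0_le0 ?(ltW r2gt0)// powR0 ?gt_eqF// !mul0r mulr0.
rewrite !max_l ?mulr_ge0 ?(ltW r2gt0) ?(ltW x0)//
  (powRM _ (ltW r2gt0) (ltW x0)) !std_normal_pdfE.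
set A := (1 / 4 * expR (- a ^+ 2)) `^ p.
set N := (Num.sqrt (2 * pi))^-1.
have N0 : 0 <= N by rewrite invr_ge0 sqrtr_ge0.
have xp0 : 0 <= x `^ p by exact: powR_ge0.
(* The constant 1/4 comes from here: 2 (symmetry), sqrt 2 (Jacobian) and (sqrt 2 / 4)^p <= sqrt 2 /
   4 multiply to at most 1, with equality at p = 1. *)
have coef : A * 2 * r2 * r2 `^ p <= expR (- a ^+ 2).
  rewrite /A powRM ?expR_ge0//.
  have e1 : expR (- a ^+ 2) `^ p <= expR (- a ^+ 2).
    by apply: ge1r_powR => //;
      rewrite expR_gt0 -[leRHS]expR0 ler_expR oppr_le0 sqr_ge0.
  have r4 : r2 / 4 <= 1.
    rewrite ler_pdivrMr// mul1r -(@ler_pXn2r _ 2)// ?nnegrE ?(ltW r2gt0)//.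
    by rewrite r22; lra.
  have r5 : (r2 / 4) `^ p <= r2 / 4.
    by apply: ge1r_powR => //; rewrite divr_gt0.
  have -> : (1 / 4) `^ p * expR (- a ^+ 2) `^ p * 2 * r2 * r2 `^ p =
            expR (- a ^+ 2) `^ p * (r2 * 2 * (r2 / 4) `^ p).
    by rewrite (powRM _ (ltW r2gt0)) ?invr_ge0// div1r; ring.
  apply: le_trans e1; rewrite ler_piMr ?powR_ge0//.
  apply: (@le_trans _ _ (r2 * 2 * (r2 / 4)));
    first by rewrite ler_wpM2l// mulr_ge0// (ltW r2gt0).
  have -> : r2 * 2 * (r2 / 4) = r2 ^+ 2 / 2 by field.
  by rewrite r22 divff.
have -> : A * 2 * r2 * (r2 `^ p * x `^ p * (N * expR (- ((r2 * x) ^+ 2 / 2)))) =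
   x `^ p * N * (A * 2 * r2 * r2 `^ p * expR (- ((r2 * x) ^+ 2 / 2))) by ring.
rewrite [leRHS]mulrA ler_wpM2l ?mulr_ge0//.
apply: (@le_trans _ _ (expR (- a ^+ 2) * expR (- ((r2 * x) ^+ 2 / 2)))).
  by rewrite ler_wpM2r ?expR_ge0.
rewrite -expRD ler_expR exprMn r22 -subr_ge0.
have -> : - ((x + a) ^+ 2 / 2) - (- a ^+ 2 - 2 * x ^+ 2 / 2) =
  (x - a) ^+ 2 / 2 by field.
by rewrite divr_ge0// sqr_ge0.
Qed.

(** Raising t <= exp t at t = |x| / (2 p) to the power [p] gives exp(|x| / 2), and |x| / 2 <= 1/4 +
    x^2 / 4. The growth exp(x^2 / 4) is half of what the Gaussian density can absorb. *)
Lemma abs_powR_le_exp (x : R) :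
  `|x| `^ p <= (2 * p) `^ p * expR (4^-1) * expR (x ^+ 2 / 4).
Proof.
have p20 : 0 < 2 * p by rewrite mulr_gt0.
have zle (z : R) : z <= expR z by apply: le_trans (expR_ge1Dx z); rewrite lerDr.
have z0 : 0 <= `|x| / (2 * p) by rewrite divr_ge0// ltW.
have -> : `|x| `^ p = (2 * p) `^ p * (`|x| / (2 * p)) `^ p.
  by rewrite -powRM// ?(ltW p20)// mulrC divfK// gt_eqF.
rewrite -mulrA ler_wpM2l ?powR_ge0//.
apply: (@le_trans _ _ (expR (`|x| / (2 * p)) `^ p)).
  by apply: ge0_ler_powR => //; rewrite ?ltW// nnegrE// expR_ge0.
rewrite -expRD -expRM ler_expR -real_normK ?num_real//.
have -> : `|x| / (2 * p) * p = `|x| / 2 by field; rewrite gt_eqF.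
have := sqr_ge0 (`|x| - 1); rewrite sqrrB1; lra.
Qed.

Lemma abs_moment_lty : (\int[gamma]_x (`|x| `^ p)%:E < +oo)%E.
Proof.
have mp : measurable_fun setT (fun x : R => (`|x| `^ p)%:E).
  by apply/measurable_EFinP; apply: (measurableT_comp (measurable_powR p)).
have mphi m s : measurable_fun setT (EFin \o normal_pdf (m : R) s).
  by apply/measurable_EFinP; exact: measurable_normal_pdf.
have p0 (x : R) : (0 <= (`|x| `^ p)%:E)%E by rewrite lee_fin powR_ge0.
rewrite integral_std_normal//.
pose r2 := Num.sqrt (2 : R).
have r22 : r2 ^+ 2 = 2 by rewrite sqr_sqrtr.
have r2n0 : r2 != 0 by rewrite gt_eqF// sqrtr_gt0.
(* exp(-x^2/2) exp(x^2/4) = exp(-x^2/4) is the profile of the normal density of standard deviation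
   sqrt 2; dividing by its peak makes [C] times that density the dominating function. *)
pose C := (2 * p) `^ p * expR 4^-1 * (Num.sqrt (2 * pi))^-1 / normal_peak r2.
have N0 : 0 <= (Num.sqrt (2 * pi) : R)^-1 by rewrite invr_ge0 sqrtr_ge0.
have C0 : 0 <= C.
  by rewrite !mulr_ge0 ?powR_ge0 ?expR_ge0// invr_ge0 normal_peak_ge0.
apply: (@le_lt_trans _ _ (\int[mu]_x (C%:E * (normal_pdf 0 r2 x)%:E))%E).
  apply: ge0_le_integral => //.
  - by move=> x _; rewrite mule_ge0// lee_fin ?powR_ge0 ?normal_pdf_ge0.
  - by apply: emeasurable_funM; [exact: mp|exact: (mphi 0 1)].
  - by apply: emeasurable_funM; [exact: measurable_cst|exact: (mphi 0 r2)].
  move=> x _; rewrite -!EFinM lee_fin std_normal_pdfE normal_pdfE// /normal_fun.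
  rewrite /C [leRHS]mulrA divfK ?gt_eqF ?normal_peak_gt0// subr0 r22.
  have -> : (2 * p) `^ p * expR 4^-1 * (Num.sqrt (2 * pi))^-1 *
      expR (- x ^+ 2 / (2 *+ 2)) = (Num.sqrt (2 * pi))^-1 *
      (expR (- (x ^+ 2 / 2)) * ((2 * p) `^ p * expR 4^-1 * expR (x ^+ 2 / 4))).
    have -> : - x ^+ 2 / (2 *+ 2) = - (x ^+ 2 / 2) + x ^+ 2 / 4 by field.
    by rewrite expRD; ring.
  rewrite mulrCA ler_wpM2l// mulrC ler_wpM2l ?expR_ge0//.
  exact: abs_powR_le_exp.
have pdf0 (x : R) : (0 <= (normal_pdf 0 r2 x)%:E)%E.
  by rewrite lee_fin normal_pdf_ge0.
have mpdf := mphi 0 r2.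
by rewrite ge0_integralZl// integral_normal_pdf mule1 ltry.
Qed.

(** Makes [cst_p] a genuine reciprocal, as the inverse of 0 is 0 by convention. On [1, 2] the power
    is at least 1 and the density at least its value at 2. *)
Lemma abs_moment_gt0 : (0 < \int[gamma]_x (`|x| `^ p)%:E)%E.
Proof.
have mp : measurable_fun setT (fun x : R => (`|x| `^ p)%:E).
  by apply/measurable_EFinP; apply: (measurableT_comp (measurable_powR p)).
have mphi : measurable_fun setT (EFin \o normal_pdf (0 : R) 1).
  by apply/measurable_EFinP; exact: measurable_normal_pdf.
have p0 (x : R) : (0 <= (`|x| `^ p)%:E)%E by rewrite lee_fin powR_ge0.
have phi0 (x : R) : 0 <= phi x by exact: normal_pdf_ge0.
rewrite integral_std_normal//.
apply: (@lt_le_trans _ _ (\int[mu]_(x in `[1%R, 2%R]) (cst (phi 2)%:E) x)%E).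
  rewrite integral_cst//= lebesgue_measure_itv/= lte_fin ltr1n -EFinD -EFinM
    lte_fin.
  have : 0 < phi 2.
    by rewrite std_normal_pdfE mulr_gt0 ?expR_gt0//
      invr_gt0 sqrtr_gt0 mulr_gt0// pi_gt0.
  by move=> phi2; rewrite mulr_gt0// subr_gt0 ltr1n.
apply: (@le_trans _ _ (\int[mu]_(x in `[1%R, 2%R]) ((`|x|
  `^ p)%:E * (phi x)%:E))%E).
  apply: ge0_le_integral => //=.
  - by move=> x _; rewrite lee_fin.
  - by apply: measurable_funTS; exact: emeasurable_funM.
  move=> x; rewrite /= in_itv/= => /andP[x1 x2].
  rewrite -EFinM lee_fin -[leLHS]mul1r ler_pM//.
    by rewrite ger0_norm ?(le_trans ler01)// (le_trans x1)// le1r_powR.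
  rewrite !std_normal_pdfE ler_wpM2l ?invr_ge0 ?sqrtr_ge0//.
  by rewrite ler_expR; nra.
apply: ge0_subset_integral => //.
- exact: emeasurable_funM.
- by move=> x _; rewrite mule_ge0// lee_fin.
Qed.

End moments.

(** * Moments of functions of a Gaussian vector *)

Section gaussian_moments.
Context {R : realType} {disp : measure_display} {Omega : measurableType disp}.
Context {P : probability Omega R} {d : nat}.
Variable Z : 'I_d -> {RV P >-> R}.
Hypothesis gZ : standard_gaussian_vector Z.
Local Notation gamma := (@std_normal R).

Lemma measurable_rvec k : measurable_fun setT (fun w => rvec Z w 0 k).
Proof.
have -> : (fun w => rvec Z w 0 k) = Z k by apply/funext => w; rewrite mxE.
exact: measurable_funP.
Qed.

Lemma ge0_integral_gaussian_coord k (f : R -> \bar R) :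
  measurable_fun setT f -> (forall x, 0 <= f x)%E ->
  (\int[P]_w f (Z k w) = \int[gamma]_x f x)%E.
Proof.
move=> mf f0; transitivity (\int[distribution P (Z k)]_x f x)%E.
  by rewrite ge0_integral_distribution.
by apply: eq_measure_integral => A mA _; exact: (proj1 gZ k A mA).
Qed.

Lemma measurable_abs_powR (p : R) : measurable_fun setT (fun x : R => (`|x|
  `^ p)%:E).
Proof.
by apply/measurable_EFinP; apply: (measurableT_comp (measurable_powR p)).
Qed.

(** The max norm is attained at a coordinate, so its p-th power is at most the sum of the |Z_k|^p,
    each with finite mean. *)
Lemma gaussian_moment_lty (p C : R) (G : 'rV[R]_d -> R) : 1 <= p -> 0 <= C ->
  continuous G -> (forall z, `|G z| <= C * `|z|) ->
  (\int[P]_w (`|G (rvec Z w)| `^ p)%:E < +oo)%E.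
Proof.
move=> p1 C0 cG GC; have p0 : 0 < p by exact: lt_le_trans ltr01 p1.
have ge0 (x : R) : (0 <= (`|x| `^ p)%:E)%E by rewrite lee_fin powR_ge0.
have mZ k : measurable_fun setT (fun w => (`|Z k w| `^ p)%:E).
  exact: (measurableT_comp (measurable_abs_powR p)).
have mS : measurable_fun setT (fun w => (\sum_k (`|Z k w| `^ p)%:E)%E).
  by apply: emeasurable_sum => k.
apply: (@le_lt_trans _ _ (\int[P]_w ((C `^ p)%:E * \sum_k (`|Z k w|
  `^ p)%:E))%E).
  apply: ge0_le_integral => //.
  - by apply: (measurableT_comp (measurable_abs_powR p));
    apply: measurable_continuous_row => //; exact: measurable_rvec.
  - exact: emeasurable_funM.
  move=> w _; rewrite sumEFin -EFinM lee_fin.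
  apply: (@le_trans _ _ ((C * `|rvec Z w|) `^ p)).
    by apply: ge0_ler_powR; rewrite ?nnegrE ?(ltW p0) ?mulr_ge0.
  rewrite powRM// ler_wpM2l ?powR_ge0//.
  have [z0|z0] := eqVneq `|rvec Z w| 0.
    by rewrite z0 powR0 ?gt_eqF// sumr_ge0// => k _; exact: powR_ge0.
  have [[i k] /= zk] := mx_norm_neq0 z0.
  rewrite [`|rvec Z w|]zk ord1 mxE (bigD1 k)//= lerDl sumr_ge0//.
rewrite ge0_integralZl//; last 2 first.
- by move=> w _; exact: sume_ge0.
- by rewrite lee_fin powR_ge0.
apply: lte_mul_pinfty; rewrite ?lee_fin ?powR_ge0//.
rewrite ge0_integral_sum//.
apply: lte_sum_pinfty => k _.
rewrite (ge0_integral_gaussian_coord k (measurable_abs_powR p))//.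
exact: abs_moment_lty.
Qed.

Lemma gaussian_integrable (C : R) (G : 'rV[R]_d -> R) : 0 <= C ->
  continuous G -> (forall z, `|G z| <= C * `|z|) ->
  P.-integrable setT (fun w => (G (rvec Z w))%:E).
Proof.
move=> C0 cG GC; apply/integrableP; split.
  by apply/measurable_EFinP; apply: measurable_continuous_row => //;
    exact: measurable_rvec.
have := gaussian_moment_lty (lexx 1) C0 cG GC.
by under eq_integral do rewrite powRr1//.
Qed.

Lemma gaussian_coord_integrable k : P.-integrable setT (fun w => (Z k w)%:E).
Proof.
have := @gaussian_integrable 1 (fun z => z 0 k) ler01.
have -> : (fun w => (rvec Z w 0 k)%:E) = (fun w => (Z k w)%:E).
  by apply/funext => w; rewrite mxE.
apply; first exact: coord_continuous.
by move=> z; rewrite mul1r row_coord_le.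
Qed.

(** Positive and negative parts have equal integrals by symmetry, finite by the first absolute
    moment, so their difference is 0. *)
Lemma gaussian_coord_mean k : (\int[P]_w (Z k w)%:E = 0)%E.
Proof.
pose pos (x : R) : \bar R := (Num.max x 0)%:E.
have mpos : measurable_fun setT pos.
  by apply/measurable_EFinP; exact: measurable_maxr.
have pos0 x : (0 <= pos x)%E by rewrite lee_fin le_max lexx orbT.
have mposN : measurable_fun setT (fun x : R =>
  pos (- x)) by exact: measurableT_comp.
rewrite integralE.
have -> : (\int[P]_w (fun w => (Z k w)%:E)^\+ w = \int[P]_w pos (Z k w))%E.
  by apply: eq_integral => w _; rewrite funeposE /pos EFin_max.
have -> : (\int[P]_w (fun w => (Z k w)%:E)^\- w =
  \int[P]_w pos (- (Z k w : R))%R)%E.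
  by apply: eq_integral => w _; rewrite funenegE /pos EFin_max.
rewrite (ge0_integral_gaussian_coord k mpos pos0).
rewrite (ge0_integral_gaussian_coord k mposN)//.
rewrite (std_normal_sym mpos pos0) subee// ge0_fin_numE;
  last exact: integral_ge0.
apply: le_lt_trans (abs_moment_lty (lexx 1)).
apply: ge0_le_integral => //; first exact: measurable_abs_powR.
move=> x _; rewrite /pos lee_fin powRr1// ge_max normr_ge0 andbT;
  exact: ler_norm.
Qed.

Lemma gaussian_dotp_mean (x : 'rV[R]_d) : (\int[P]_w (dotp (rvec Z w) x)%:E =
  0)%E.
Proof.
transitivity (\int[P]_w (\sum_(k < d) (x 0 k)%:E * (Z k w)%:E))%E.
  apply: eq_integral => w _; rewrite /dotp -sumEFin; apply: eq_bigr => k _.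
  by rewrite mxE -EFinM mulrC.
rewrite integral_sum//; last first.
  by move=> k; apply: integrableZl => //; exact: gaussian_coord_integrable.
rewrite big1// => k _; rewrite integralZl//;
  last exact: gaussian_coord_integrable.
by rewrite gaussian_coord_mean mule0.
Qed.

End gaussian_moments.

(** * The directional lower bound *)

Section directional_bound.
Context {R : realType} {disp : measure_display} {Omega : measurableType disp}.
Context {P : probability Omega R} {d : nat}.
Variable Z : 'I_d -> {RV P >-> R}.
Hypothesis gZ : standard_gaussian_vector Z.
Local Notation gamma := (@std_normal R).

Lemma prob_jensen_pospart (p b v : R) (H : Omega -> R) : 1 <= p -> 0 <= v ->
  measurable_fun setT H -> (forall w, 0 <= H w) ->
  (\int[P]_w (H w)%:E <= v%:E)%E ->
  (((Num.max (b - v) 0) `^ p)%:E <= \int[P]_w ((Num.max (b - H w) 0) `^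
    p)%:E)%E.
Proof.
move=> p1 v0 mH H0 Hv; have p0 : 0 < p by exact: lt_le_trans ltr01 p1.
have [bv|bv] := leP (b - v) 0.
  rewrite powR0 ?gt_eqF//.
  by apply: integral_ge0 => w _; rewrite lee_fin powR_ge0.
(* [y |-> m ^ p + c (v - y)] is tangent to [(b - y) ^ p] at [y = v]. *)
set m := b - v; pose c := p * m `^ (p - 1).
have c0 : 0 <= c by rewrite mulr_ge0 ?powR_ge0 ?ltW.
have mH' : measurable_fun setT (fun w => (H w)%:E) by exact/measurable_EFinP.
have mpos : measurable_fun setT (fun w => ((Num.max (b - H w) 0) `^ p)%:E).
  by apply: (measurable_pospart_powR p (f := fun w => b - H w));
    exact: measurable_funB.
have pos0 w : (0 <= ((Num.max (b - H w) 0) `^ p)%:E)%E by rewrite lee_fin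
  powR_ge0.
(* Moving the term c v to the left and c H to the right keeps all integrands nonnegative; c >= 0
   then allows the mean of [H] to be replaced by its upper bound [v]. *)
rewrite -(@leeD2rE _ (c * v)%:E)//.
apply: (@le_trans _ _ (\int[P]_w (((Num.max (b - H w) 0) `^ p)%:E + c%:E * (H
  w)%:E))%E).
  rewrite -[leLHS]mule1 -(@probability_setT _ _ _ P) -integral_cst//.
  apply: ge0_le_integral => //=.
  - by move=> w _; rewrite -EFinD lee_fin; apply: addr_ge0;
    [exact: powR_ge0|exact: mulr_ge0].
  - by apply: emeasurable_funD => //; exact: emeasurable_funM.
  move=> w _; rewrite -EFinM -!EFinD lee_fin.
  have x0 : 0 <= Num.max (b - H w) 0 by rewrite le_max lexx orbT.
  have := powR_tangent p1 bv x0; rewrite -/m -/c.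
  have : b - H w <= Num.max (b - H w) 0 by rewrite le_max lexx.
  by rewrite /m; nra.
rewrite ge0_integralD//; last 2 first.
- by move=> w _; rewrite mule_ge0// lee_fin.
- exact: emeasurable_funM.
rewrite leeD2l// ge0_integralZl//; last by move=> w _; rewrite lee_fin.
by rewrite [leRHS]EFinM; apply: lee_wpmul2l => //; rewrite lee_fin.
Qed.

Variables (K L M : set 'rV[R]_d) (C : R).
Hypotheses (L0 : L !=set0) (MC : forall y, M y -> `|y| <= C).
Hypotheses (KM : K `<=` M) (LM : L `<=` M).

Let M0 : M !=set0. Proof. by have [y /LM My] := L0; exists y. Qed.
Let KC y : K y -> `|y| <= C. Proof. by move=> /KM /MC. Qed.
Let LC y : L y -> `|y| <= C. Proof. by move=> /LM /MC. Qed.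
Let C0 : 0 <= C. Proof. by have [y /MC] := M0; exact: le_trans. Qed.

(** Testing h_K at [x] bounds it below by s <u,x> + <z,x>; subadditivity bounds h_L above by s
    h_L(u) + h_M(z). For s <= 0 the left side is 0, because h_M(z) >= <z,x>. *)
Lemma support_gap (u x z : 'rV[R]_d) (a s : R) : K x -> 0 < a ->
  support_fun L u + a <= dotp u x ->
  Num.max (a * s - (support_fun M z - dotp z x)) 0 <=
  `|support_fun K (s *: u + z) - support_fun L (s *: u + z)|.
Proof.
move=> Kx a0 ux; rewrite ge_max normr_ge0 andbT.
have H0 : 0 <= support_fun M z - dotp z x.
  by rewrite subr_ge0 (support_fun_ge MC)//; exact: KM.
have [s0|s0] := leP s 0.
  apply: (@le_trans _ _ 0) => //.
  by rewrite subr_le0 (le_trans _ H0)// pmulr_rle0.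
apply: le_trans (ler_norm _).
have hK := support_fun_ge KC (s *: u + z) Kx.
have hL := support_funD L0 LC (s *: u) z.
have hLs := support_funZ L0 LC u (ltW s0).
have hLM : support_fun L z <= support_fun M z.
  by apply: (support_fun_le L0) => y Ly; apply: (support_fun_ge MC); exact: LM.
have := ler_wpM2l (ltW s0) ux; rewrite dotpDl dotpZl in hK; rewrite mulrDr.
lra.
Qed.

Lemma directional_bound (p a : R) (u x : 'rV[R]_d) :
  1 <= p -> K x -> 0 < a -> dotp u u = 1 ->
  support_fun L u + a <= dotp u x ->
  (((1 / 4 * a *
      expR (- (fine (\int[P]_w (support_fun M (rvec Z w))%:E) / a) ^+ 2)) `^
        p)%:E *
    \int[gamma]_s (`|s| `^ p)%:E <=
   \int[P]_w (`|support_fun K (rvec Z w) - support_fun L (rvec Z w)|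
     `^ p)%:E)%E.
Proof.
move=> p1 Kx a0 u1 ux.
have p0 : 0 < p by exact: lt_le_trans ltr01 p1.
have K0 : K !=set0 by exists x.
pose H z := support_fun M z - dotp z x.
have H0 z : 0 <= H z.
  by rewrite subr_ge0 (support_fun_ge MC)//; exact: KM.
have cdot : continuous (fun z => dotp z x).
  apply: (@lipschitz_continuous_real _ _ _ (d%:R * `|x|)) => y z.
  by rewrite -dotpNl -dotpDl -mulrA (mulrC `|x|) dotp_le.
have cM := continuous_support_fun M0 MC.
have cH : continuous H by move=> z; apply: (cvgB (cM z) (cdot z)).
have cK := continuous_support_fun K0 KC;
  have cL := continuous_support_fun L0 LC.
pose f z := support_fun K z - support_fun L z.
have cf : continuous f by move=> z; apply: (cvgB (cK z) (cL z)).
pose g (t : R) := `|t| `^ p.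
have mg : measurable_fun setT g.
  by apply: (measurableT_comp (measurable_powR p)).
have gf0 z : 0 <= g (f z) by exact: powR_ge0.
have [|W [mW WE]] := gaussian_split (u := u) gZ.
  by rewrite -[RHS]u1; apply: eq_bigr => k _; rewrite expr2.
set v := fine _.
(* <Z, x> has mean zero, so H(Z) has the same mean as h_M(Z). *)
have EHv : (\int[P]_w (H (rvec Z w))%:E = v%:E)%E.
  have iM : P.-integrable setT (fun w => (support_fun M (rvec Z w))%:E).
    apply: (gaussian_integrable gZ (C := d%:R * C)) => //;
      first exact: mulr_ge0.
    exact: support_fun_abs.
  have idot : P.-integrable setT (fun w => (dotp (rvec Z w) x)%:E).
    apply: (gaussian_integrable gZ (G := fun z => dotp z x) (C :=
      d%:R * `|x|)) => //.
    move=> z; rewrite ler_norml -mulrA (mulrC `|x|) dotp_le andbT.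
    by rewrite lerNl -dotpNl -(normrN z) dotp_le.
  under eq_integral do rewrite EFinB.
  rewrite integralB// gaussian_dotp_mean// sube0 fineK//.
  exact: integrable_fin_num.
have v0 : 0 <= v by rewrite -lee_fin -EHv; apply: integral_ge0 => w _;
  rewrite lee_fin.
have mHW : measurable_fun setT (H \o W) by exact: measurable_continuous_row.
have EHW : (\int[P]_w (H (W w))%:E <= v%:E)%E.
  (* [s |-> E H(s u + W)] is convex, and the law of [s] is symmetric. *)
  pose J s := (\int[P]_w (H (s *: u + W w))%:E)%E.
  have mJ : measurable_fun setT J.
    apply: (measurable_fun_fubini_tonelli_F (m2 := P)
      (fun z : R * Omega => (H (z.1 *: u + W z.2))%:E)) => [|z].
      exact: (@measurable_line _ _ _ _ u W H id cH (@measurable_id _ _ setT)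
        mW).
    by rewrite lee_fin.
  have mJN : measurable_fun setT (fun s : R =>
    J (- s)) by exact: measurableT_comp.
  have mHs s : measurable_fun setT (fun w => (H (s *: u + W w))%:E).
    apply/measurable_EFinP;
      apply: (measurable_continuous_row (X := fun w => s *: u + W w)) => // k.
    under eq_fun do rewrite mxE mxE.
    exact: measurable_funD.
  have J0 s : (0 <= J s)%E by apply: integral_ge0 => w _; rewrite lee_fin.
  have EJ : (\int[gamma]_s J s = v%:E)%E by rewrite -EHv (WE H id).
  have two z : (2%:E * z = z + z :> \bar R)%E.
    by rewrite -[2]/(1 + 1) EFinD ge0_muleDl// mul1e.
  rewrite -(@lee_pmul2l _ 2%:E)// !two.
  set A := (\int[P]_w (H (W w))%:E)%E.
  have A0 : (0 <= A)%E by apply: integral_ge0 => w _; rewrite lee_fin.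
  have mHWE : measurable_fun setT (fun w =>
    (H (W w))%:E) by exact/measurable_EFinP.
  have -> : (v%:E + v%:E = \int[gamma]_s (J s + J (- s)%R))%E.
    by rewrite ge0_integralD// std_normal_sym// EJ.
  have -> : (A + A = \int[gamma]_s (cst (A + A)%E s))%E.
    by rewrite integral_cst// [X in (_ * X)%E]std_normal_setT mule1.
  apply: ge0_le_integral => //.
  - by move=> s _; exact: adde_ge0.
  - exact: emeasurable_funD.
  move=> s _; rewrite /= /A /J -ge0_integralD//; last 2 first.
  - by move=> w _; rewrite lee_fin.
  - by move=> w _; rewrite lee_fin.
  rewrite -ge0_integralD//; last 2 first.
  - by move=> w _; rewrite lee_fin.
  - by move=> w _; rewrite lee_fin.
  apply: ge0_le_integral => //.
  - by move=> w _; rewrite -EFinD lee_fin addr_ge0.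
  - exact: emeasurable_funD.
  - exact: emeasurable_funD.
  move=> w _; rewrite -!EFinD lee_fin /H.
  (* W is the midpoint of s u + W and - s u + W. *)
  have : support_fun M (W w) <=
    (support_fun M (s *: u + W w) + support_fun M (- s *: u + W w)) / 2.
    apply: (support_fun_le M0) => y My.
    have := support_fun_ge MC (s *: u + W w) My.
    have := support_fun_ge MC (- s *: u + W w) My.
    rewrite !dotpDl !dotpZl; lra.
  rewrite !dotpDl !dotpZl; lra.
rewrite [leRHS](WE f g cf mg gf0).
(* For fixed [s], Jensen in [w] replaces v by H(W w), and [support_gap] at z = W w bounds the
   resulting integrand pointwise. *)
apply: (@le_trans _ _ (\int[gamma]_s ((Num.max (a * s - v) 0) `^ p)%:E)%E);
  last first.
  have mline := @measurable_line _ _ _ _ u W f g cf mg mW.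
  have mpart b (h : Omega -> R) : measurable_fun setT h ->
      measurable_fun setT (fun w => ((Num.max (b - h w) 0) `^ p)%:E).
    move=> mh; apply: (measurable_pospart_powR p (f := fun w => b - h w)).
    exact: measurable_funB.
  apply: ge0_le_integral => //.
  - by move=> s _; rewrite lee_fin powR_ge0.
  - apply: (measurable_pospart_powR p (f := fun s => a * s - v)).
    by apply: measurable_funB => //; exact: measurable_funM.
  - apply: (measurable_fun_fubini_tonelli_F (m2 := P)
      (fun z : R * Omega => (g (f (z.1 *: u + W z.2)))%:E)) => // z.
    by rewrite lee_fin.
  move=> s _; apply: le_trans (prob_jensen_pospart _ p1 v0 mHW (fun w =>
    H0 (W w)) EHW) _.
  apply: ge0_le_integral => //.
  - by move=> w _; rewrite lee_fin powR_ge0.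
  - exact: mpart.
  - exact: (measurableT_comp mline (measurable_pair1 s)).
  move=> w _; rewrite lee_fin; apply: ge0_ler_powR; rewrite ?nnegrE ?(ltW p0)//.
    by rewrite le_max lexx orbT.
  exact: support_gap.
(* Factoring out a^p leaves a shift by v / a, the form of [shifted_moment_ge]. *)
have -> : (\int[gamma]_s ((Num.max (a * s - v) 0) `^ p)%:E =
           (a `^ p)%:E * \int[gamma]_s ((Num.max (s - v / a) 0) `^ p)%:E)%E.
  have mp : measurable_fun setT (fun s : R =>
    ((Num.max (s - v / a) 0) `^ p)%:E).
    apply: (@measurable_pospart_powR R p _ R (fun s : R => s - v / a)).
    exact: measurable_funB.
  have nn s : (0 <= ((Num.max (s - v / a) 0) `^ p)%:E)%E by rewrite lee_fin
    powR_ge0.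
  rewrite -ge0_integralZl// ?lee_fin ?powR_ge0//.
  apply: eq_integral => s _;
    rewrite -EFinM -powRM ?(ltW a0) ?le_max ?lexx ?orbT//.
  congr (_ `^ _)%:E;
    rewrite maxr_pMr ?(ltW a0)// mulr0 mulrBr mulrCA divff ?mulr1//.
  by rewrite gt_eqF.
rewrite (mulrAC _ a) powRM ?(ltW a0) ?mulr_ge0 ?expR_ge0//
  EFinM muleAC (muleC _ (a `^ p)%:E).
rewrite lee_wpmul2l ?lee_fin ?powR_ge0//.
exact: shifted_moment_ge.
Qed.

End directional_bound.

(** * The lower bound for the intrinsic metric *)

Lemma cst_pE (R : realType) (p : R) :
  cst_p p = (fine (\int[std_normal]_s (`|s| `^ p)%:E)%E)^-1.
Proof.
rewrite /cst_p unlock; congr (fine _)^-1; apply/esym.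
apply: integral_std_normalE; first exact: measurable_abs_powR.
by move=> x; rewrite lee_fin powR_ge0.
Qed.

Lemma hull_bound (R : realType) (d : nat) (K L : set 'rV[R]_d) :
  convex_body K -> convex_body L ->
  exists C, forall y, closed_convex_hull (K `|` L) y -> `|y| <= C.
Proof.
move=> [_ /compact_norm_bounded[C1 KC] _] [_ /compact_norm_bounded[C2 LC] _].
exists (Num.max C1 C2); apply: closed_convex_hull_bounded => y [/KC|/LC] h.
  by rewrite le_max h.
by rewrite le_max h orbT.
Qed.

Theorem theorem2 (R : realType) (p : R) (d : nat)
  (disp : measure_display) (Omega : measurableType disp)
  (P : probability Omega R) (Z : 'I_d -> {RV P >-> R})
  (K L : set 'rV[R]_d) :
  1 <= p -> (1 <= d)%N ->
  standard_gaussian_vector Z ->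
  convex_body K -> convex_body L -> K <> L ->
  1 / 4 * hausdorff_dist K L *
    expR (- (1 / (2 * pi) *
      (intrinsic_volume1 Z (closed_convex_hull (K `|` L)) /
       hausdorff_dist K L) ^+ 2))
  <= intrinsic_Lp_dist Z p K L.
Proof.
move=> p1 _ gZ bK bL KL; have p0 : 0 < p by exact: lt_le_trans ltr01 p1.
have [K0 cK _] := bK; have [L0 cL _] := bL.
have [a0 [u [x [u1 ux]]]] := hausdorff_direction bK bL KL.
have [C MC] := hull_bound bK bL.
set M := closed_convex_hull (K `|` L) in MC *.
set a := hausdorff_dist K L in a0 ux *.
have KLM : K `|` L `<=` M by exact: closed_convex_hull_sub.
have KM : K `<=` M by move=> y Ky; apply: KLM; left.
have LM : L `<=` M by move=> y Ly; apply: KLM; right.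
pose v := fine (\int[P]_w (support_fun M (rvec Z w))%:E)%E.
pose E := (\int[P]_w (`|support_fun K (rvec Z w) - support_fun L (rvec Z w)|
  `^ p)%:E)%E.
pose m := (\int[@std_normal R]_s (`|s| `^ p)%:E)%E.
set b := 1 / 4 * a * expR _.
(* The square of the normalizing factor sqrt (2 pi) in V_1 cancels 1 / (2 pi). *)
have -> : b = 1 / 4 * a * expR (- (v / a) ^+ 2).
  rewrite /b; congr (_ * expR (- _)).
  rewrite /intrinsic_volume1 unlock -/v !exprMn sqr_sqrtr; last first.
    by rewrite mulr_ge0// pi_ge0.
  have an0 : a != 0 by rewrite gt_eqF.
  have pin0 : (pi : R) != 0 by rewrite gt_eqF// pi_gt0.
  by move: (pi : R) pin0 => q q0; field; rewrite an0 q0.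
set b' := 1 / 4 * a * expR _.
have b'0 : 0 <= b' by rewrite !mulr_ge0 ?expR_ge0// ltW.
have bound : ((b' `^ p)%:E * m <= E)%E.
  (* The far point may lie in either body; the hull contains both and the integrand is symmetric, so
     the roles of K and L can be exchanged. *)
  case: ux => [[Kx ux]|[Lx ux]].
    exact: (directional_bound gZ L0 MC KM LM p1 Kx a0 u1 ux).
  have := directional_bound gZ K0 MC LM KM p1 Lx a0 u1 ux.
  rewrite -/v -/b' -/m => /le_trans; apply.
  by under eq_integral do rewrite distrC.
have mfin : m \is a fin_num.
  by rewrite ge0_fin_numE ?abs_moment_lty//; apply: ltW; exact: abs_moment_gt0.
have m0 : 0 < fine m by rewrite fine_gt0// abs_moment_gt0//= abs_moment_lty.
have E0 : (0 <= E)%E by apply: integral_ge0 => w _; rewrite lee_fin powR_ge0.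
(* [fine] would send an infinite expectation to 0; the linear growth of support functions rules this
   out. *)
have Efin : E \is a fin_num.
  rewrite ge0_fin_numE//.
  have KC y : K y -> `|y| <= C by move=> /KM /MC.
  have LC y : L y -> `|y| <= C by move=> /LM /MC.
  have C0 : 0 <= C by have [y /KC] := K0; exact: le_trans.
  have cfK := continuous_support_fun K0 KC;
    have cfL := continuous_support_fun L0 LC.
  apply: (gaussian_moment_lty gZ (G := fun z =>
    support_fun K z - support_fun L z)
    (C := 2 * (d%:R * C)) p1) => //.
  - by rewrite !mulr_ge0.
  - by move=> z; apply: (cvgB (cfK z) (cfL z)).
  move=> z; rewrite (le_trans (ler_normB _ _))//.
  have := support_fun_abs K0 KC z; have := support_fun_abs L0 LC z; lra.
rewrite /intrinsic_Lp_dist unlock cst_pE -/m -[in leRHS]/E.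
(* Written as a p-th root, b' is compared through p-th powers: dividing [bound] by the positive
   moment [m] produces c_p. *)
have -> : b' = (b' `^ p) `^ p^-1 by rewrite -powRrM divff ?powRr1// gt_eqF.
apply: ge0_ler_powR; rewrite ?nnegrE ?invr_ge0 ?(ltW p0) ?powR_ge0//.
  by apply: mulr_ge0; [rewrite invr_ge0 ltW|exact: fine_ge0].
rewrite mulrC ler_pdivlMr//.
by move: bound; rewrite -(fineK mfin) -(fineK Efin) -EFinM lee_fin.
Qed.
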